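(* Let $n$ and $m$ be positive integers, let $\Lambda=(\Lambda,b)$ be a lattice of type $A_n$, of type $D_n$ (with $n\ge 4$), or of type $E_n$ with $n\in\{6,7\}$, and let $C$ be an $R$-code of length $m$, where - $R=\mathbb{Z}/(n+1)\mathbb{Z}$ if $\Lambda$ is of type $A_n$; - $R=\mathbb{Z}/4\mathbb{Z}$ if $\Lambda$ is of type $D_n$ with $n$ odd; - $R=\mathbb{F}_2+u\mathbb{F}_2$ if $\Lambda$ is of type $D_n$ with $n$ even; - $R=\mathbb{Z}/3\mathbb{Z}$ if $\Lambda$ is of type $E_6$; - $R=\mathbb{Z}/2\mathbb{Z}$ if $\Lambda$ is of type $E_7$. Then there exists a mapping $\rho^{\oplus m}:(\Lambda^* )^{\oplus m}\to R^{\oplus m}$ (the coordinatewise $m$-fold direct sum of a mapping $\rho:\Lambda^*\to R$) such that, with $\Gamma_C:=(\rho^{\oplus m})^{-1}(C)\subset(\Lambda^* )^{\oplus m}$, the lattice $(\Gamma_C,B)$ is even unimodular if and only if - $C$ is Type II, in case $\Lambda$ is of type $A_n$ with $n$ odd; - $C$ is Euclidean self-dual, in case $\Lambda$ is of type $A_n$ with $n$ even; - $C$ is Type II, in case $\Lambda$ is of type $D_n$ with $n$ odd; - $C$ is Type II, in case $\Lambda$ is of type $D_n$ with $n\in 2\mathbb{Z}$ and $n\notin 4\mathbb{Z}$; - $C$ is Type IV, in case $\Lambda$ is of type $D_n$ with $n\in 4\mathbb{Z}$; - $C$ is Euclidean self-dual, in case $\Lambda$ is of type $E_6$; - $C$ is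 Type II, in case $\Lambda$ is of type $E_7$.
   Context: **Lattices.** A lattice is a free $\mathbb{Z}$-module $\Lambda$ of finite rank with a positive-definite symmetric bilinear form $b:\Lambda\times\Lambda\to\mathbb{R}$, extended $\mathbb{R}$-bilinearly to $\Lambda\otimes\mathbb{R}$. Its dual is $\Lambda^*=\{x\in\Lambda\otimes\mathbb{R} : b(x,y)\in\mathbb{Z}\ \forall y\in\Lambda\}$. It is integral if $b(x,y)\in\mathbb{Z}$ for all $x,y\in\Lambda$; even if it is integral and $b(x,x)\in2\mathbb{Z}$ for all $x\in\Lambda$; unimodular if $\Lambda^*=\Lambda$. $\Lambda$ is of type $A_n$ if it has a basis $(e_1,\dots,e_n)$ with $b(e_i,e_i)=2$, $b(e_i,e_j)=-1$ if $|i-j|=1$, and $0$ otherwise. $\Lambda$ is of type $D_n$ ($n\ge4$) if it has a basis with $b(e_i,e_i)=2$, $b(e_i,e_j)=-1$ if ($|i-j|=1$ and $\{i,j\}\ne\{n-1,n\}$) or $\{i,j\}=\{n-2,n\}$, and $0$ otherwise. $\Lambda$ is of type $E_n$ ($n=6,7,8$) if it has a basis with $b(e_i,e_i)=2$, $b(e_i,e_j)=-1$ if ($|i-j|=1$ and $\{i,j\}\neq\{n-1,n\}$) or $\{i,j\}=\{n-3,n\}$, and $0$ otherwise. On $(\Lambda^* )^{\oplus m}$ (and hence on $\Gamma_C$) the bilinear form is $B(x,y)=\sum_{i=1}^m b(x_i,y_i)$. **Codes.** $\mathbb{F}_2+u\mathbb{F}_2=\{0,1,u,1+u\}$ is the commutative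 ring of order four and characteristic two with $u^2=0$. An $R$-code of length $m$ is an $R$-submodule $C$ of $R^{\oplus m}$. With $x\cdot y=\sum_i x_iy_i$, the dual code is $C^\perp=\{x\in R^{\oplus m}: x\cdot y=0\ \forall y\in C\}$; $C$ is Euclidean self-dual if $C=C^\perp$. For $x\in(\mathbb{Z}/N\mathbb{Z})^{\oplus m}$, $l_k(x)$ is the number of coordinates of $x$ equal to the class of $k$, and the Euclidean weight is $\mathrm{wt}_{\mathrm E}(x)=\sum_{k=1}^{N}k^2\,l_k(x)$. A Euclidean self-dual code $C$ over $\mathbb{Z}/N\mathbb{Z}$ is Type II if $\mathrm{wt}_{\mathrm E}(x)\in 2N\mathbb{Z}$ for every $x\in C$. For $x\in(\mathbb{F}_2+u\mathbb{F}_2)^{\oplus m}$, let $N_0(x)$ be the number of coordinates equal to $0$, $N_2(x)$ the number equal to $u$, and $N_1(x)=m-N_0(x)-N_2(x)$. The Hamming weight is $\mathrm{wt}_{\mathrm H}(x)=N_1(x)+N_2(x)$ and the Lee weight is $\mathrm{wt}_{\mathrm L}(x)=N_1(x)+2N_2(x)$. A Euclidean self-dual code $C$ over $\mathbb{F}_2+u\mathbb{F}_2$ is Type II if $\mathrm{wt}_{\mathrm L}(x)\in4\mathbb{Z}$ for all $x\in C$, and Type IV if $\mathrm{wt}_{\mathrm H}(x)\in2\mathbb{Z}$ for all $x\in C$. *)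

(* Defs.v *)
From HB Require Import structures.
From mathcomp Require Import all_boot all_order all_algebra.
From mathcomp Require Import classical_sets reals.

Set Implicit Arguments.
Unset Strict Implicit.
Unset Printing Implicit Defensive.

Import Order.TTheory GRing.Theory Num.Theory.
Local Open Scope classical_set_scope.
Local Open Scope ring_scope.

(** * Lattices

   A lattice is represented inside a finite-dimensional Euclidean space (V, b)
   as the Z-span L of an R-linearly independent family.  The R-span of L in V
   is then L (x) R, and the restriction of b to it is the R-bilinear extension
   of the form of the lattice. *)

Section Lattices.
Context {R : realType} {V : vectType R}.
Implicit Types (L : set V) (b : {dot V for idfun}).

(* For a lattice L, a family in L is a Z-basis of L if and only if it is an
   R-basis of L (x) R that generates L as an abelian group. *)
Definition is_Zbasis L (r : nat) (e : r.-tuple V) : Prop :=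
  free e /\ L = [set x : V | inIntSpan e x].

Definition is_lattice L : Prop :=
  exists r : nat, exists e : r.-tuple V, is_Zbasis L e.

Definition real_span L : set V :=
  [set x : V | exists2 s : seq V, (forall y, y \in s -> L y) & x \in <<s>>%VS].

Definition dual_lattice b L : set V :=
  [set x : V | real_span L x /\ forall y, L y -> b x y \is a Num.int].

Definition integral b L : Prop :=
  forall x y, L x -> L y -> b x y \is a Num.int.

Definition even_lattice b L : Prop :=
  integral b L /\ forall x, L x -> exists k : int, b x x = (2 * k)%:~R.

Definition unimodular b L : Prop := dual_lattice b L = L.

Definition even_unimodular b L : Prop := even_lattice b L /\ unimodular b L.

(** ** Root lattices of type A_n, D_n, E_n.
   The adjacency relations are stated on the indices 1, ..., n. *)

Definition is_pair (i j p q : nat) : bool :=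
  ((i == p) && (j == q)) || ((i == q) && (j == p)).

Definition consecutive (i j : nat) : bool := (j == i.+1) || (i == j.+1).

Definition adjA (i j : nat) : bool := consecutive i j.

Definition adjD (n i j : nat) : bool :=
  (consecutive i j && ~~ is_pair i j (n - 1) n) || is_pair i j (n - 2) n.

Definition adjE (n i j : nat) : bool :=
  (consecutive i j && ~~ is_pair i j (n - 1) n) || is_pair i j (n - 3) n.

Definition has_graph b L (n : nat) (adj : rel nat) : Prop :=
  exists2 e : n.-tuple V, is_Zbasis L e &
    forall i j : 'I_n, b (tnth e i) (tnth e j) =
      if i == j then 2 else if adj i.+1 j.+1 then -1 else 0.

Definition typeA b L (n : nat) : Prop := has_graph b L n adjA.
Definition typeD b L (n : nat) : Prop := (4 <= n)%N /\ has_graph b L n (adjD n).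
Definition typeE b L (n : nat) : Prop :=
  (6 <= n <= 8)%N /\ has_graph b L n (adjE n).

End Lattices.

(** ** The form B on the direct sum of m copies of V *)

Section PowerForm.
Context {R : realType} {V : vectType R} (b : {dot V for idfun}) (m : nat).

Definition power_form (x y : {ffun 'I_m -> V}) : R := \sum_(i < m) b (x i) (y i).

Let power_form_linear_l y : scalar (power_form^~ y).
Proof.
move=> a u v; rewrite /power_form mulr_sumr -big_split /=.
by apply: eq_bigr => i _; rewrite !ffunE linearPl.
Qed.

Let power_form_linear_r x :
  linear_for (@GRing.mul R) (power_form x).
Proof.
move=> a u v; rewrite /power_form mulr_sumr -big_split /=.
by apply: eq_bigr => i _; rewrite !ffunE linearPr.
Qed.

HB.instance Definition _ :=
  bilinear_isBilinear.Build R {ffun 'I_m -> V} {ffun 'I_m -> V} R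
    *%R (idfun \; *%R) power_form
    (power_form_linear_l, power_form_linear_r).

Let power_form_sym x y :
  power_form x y = (-1) ^+ false * idfun (power_form y x).
Proof.
rewrite expr0 mul1r /power_form /=; apply: eq_bigr => i _.
by rewrite hermC expr0 mul1r.
Qed.

HB.instance Definition _ :=
  isHermitianSesquilinear.Build R {ffun 'I_m -> V} false idfun power_form
    power_form_sym.

Let power_form_gt0 x : x != 0 -> 0 < power_form x x.
Proof.
move=> x_neq0; have b_ge0 (v : V) : 0 <= b v v.
  have [->|/(@neq0_dnorm_gt0 _ _ _ b)/ltW //] := eqVneq v 0.
  by rewrite linear0l.
have [i xi_neq0] : exists i, x i != 0.
  apply/existsP; apply: contraNT x_neq0 => /existsPn x0.
  by apply/eqP/ffunP => i; rewrite ffunE; apply/eqP; have := x0 i; rewrite negbK.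
rewrite /power_form (bigD1 i) //= ltr_pwDl //; last exact: sumr_ge0.
exact: (@neq0_dnorm_gt0 _ _ _ b).
Qed.

HB.instance Definition _ :=
  isDotProduct.Build R {ffun 'I_m -> V} power_form power_form_gt0.

End PowerForm.

(** * Codes *)

Section Codes.
Context {S : finComNzRingType} {m : nat}.
Implicit Type C : {set 'rV[S]_m}.

Definition is_code C : Prop := submod_closed C.

Definition dual_code C : {set 'rV[S]_m} :=
  [set x : 'rV[S]_m | [forall y in C, \sum_(i < m) x 0 i * y 0 i == 0]]%SET.

Definition self_dual C : Prop := dual_code C = C.

End Codes.

(** ** Codes over Z/NZ, for N >= 2 *)

Section CodesZ.
Context (N : nat) {m : nat}.
Implicit Types (x : 'rV['Z_N]_m) (C : {set 'rV['Z_N]_m}).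

Definition num_coord x (k : nat) : nat := #|[set i : 'I_m | x 0 i == k%:R]%SET|.

Definition euclidean_weight x : nat :=
  (\sum_(1 <= k < N.+1) k ^ 2 * num_coord x k)%N.

Definition typeII_Z C : Prop :=
  self_dual C /\ forall x, x \in C -> (2 * N %| euclidean_weight x)%N.

End CodesZ.

Arguments num_coord N {m} x k.
Arguments euclidean_weight N {m} x.
Arguments typeII_Z N {m} C.

(** ** Codes over F_2 + u F_2 = F_2[u] / (u ^ 2) *)

Definition F2uF2 : Type := {poly %/ ('X^2 : {poly 'F_2})}.
HB.instance Definition _ := Finite.on F2uF2.
HB.instance Definition _ := GRing.ComNzRing.on F2uF2.
Definition F2u : F2uF2 := 'qX.

Section CodesF2u.
Context {m : nat}.
Implicit Types (x : 'rV[F2uF2]_m) (C : {set 'rV[F2uF2]_m}).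

Definition N0 x : nat := #|[set i : 'I_m | x 0 i == 0]%SET|.
Definition N2 x : nat := #|[set i : 'I_m | x 0 i == F2u]%SET|.
Definition N1 x : nat := (m - N0 x - N2 x)%N.

Definition hamming_weight x : nat := (N1 x + N2 x)%N.
Definition lee_weight x : nat := (N1 x + 2 * N2 x)%N.

Definition typeII_F2u C : Prop :=
  self_dual C /\ forall x, x \in C -> (4 %| lee_weight x)%N.
Definition typeIV_F2u C : Prop :=
  self_dual C /\ forall x, x \in C -> (2 %| hamming_weight x)%N.

End CodesF2u.

(** * The construction *)

Section Construction.
Context {R : realType} {V : vectType R} {S : finComNzRingType} {m : nat}.

Definition map_power (rho : V -> S) (x : {ffun 'I_m -> V}) : 'rV[S]_m :=
  \row_i rho (x i).

(* Only the restriction of rho to the dual lattice of L matters: a function on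
   V stands for an arbitrary mapping from the dual lattice to S. *)
Definition Gamma (b : {dot V for idfun}) (L : set V) (rho : V -> S)
    (C : {set 'rV[S]_m}) : set {ffun 'I_m -> V} :=
  [set x : {ffun 'I_m -> V} |
    (forall i, dual_lattice b L (x i)) /\ map_power rho x \in C].

Definition even_unimodular_iff (b : {dot V for idfun}) (L : set V)
    (C : {set 'rV[S]_m}) (P : Prop) : Prop :=
  exists rho : V -> S,
    is_lattice (Gamma b L rho C) /\
    (even_unimodular (@power_form R V b m) (Gamma b L rho C) <-> P).

End Construction.

(* Main.v *)
Require Import Defs.
From HB Require Import structures.
From mathcomp Require Import all_boot all_order all_algebra.
From mathcomp Require Import boolp classical_sets reals.
From mathcomp Require Import zify ring lra.

Set Implicit Arguments.
Unset Strict Implicit.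
Unset Printing Implicit Defensive.

Import Order.TTheory GRing.Theory Num.Theory.
Local Open Scope ring_scope.

(** Write L* for the dual of the root lattice L. The quotient L* / L is
   isomorphic to the additive group of the ring S: it is cyclic of order n + 1,
   4, 3, 2 in types A_n, D_n (n odd), E_6, E_7, and it is Klein's four-group in
   type D_n (n even). The map rho is the composition of L* -> L* / L with such
   an isomorphism. The isomorphisms are given by glue vectors, representatives
   in L* of the elements of S, and they are chosen so that the form of L*,
   taken modulo the integers, is the product of S followed by an additive
   character chi of S whose kernel contains no nonzero ideal.

   This compatibility makes the dual of Gamma_C equal to Gamma of the dual code
   (dual_Gamma). A vector pairing integrally with the copies of L inside Gamma_C
   has its coordinates in L*, and for such vectors
   B (x, y) = chi (rho (x) . rho (y)) modulo the integers. When y ranges over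
   Gamma_C the products rho (x) . rho (y) form an ideal of S, so that they all
   lie in the kernel of chi only if they all vanish. As rho is onto, Gamma_C is
   unimodular if and only if C is self-dual. Since L is even, B (x, x) modulo 2
   depends only on the codeword rho (x) and is the sum of the norms of the glue
   vectors of its letters (even_unimodular_Gamma).

   It remains to read these norms as weights. In the cyclic case, if g
   generates and b (g, g) = q / N, the norm of a codeword c is q / N times the
   sum of the squares of its letters. For N even this is an even integer exactly
   when 2 N divides the Euclidean weight. For N odd and q even it is an even
   integer as soon as c . c = 0. In type D_n with n even the letters 1 and
   1 + u are represented by the two spinor classes, of norm n / 4, and u by the
   vector class, of norm 1, so the norm is n / 4 N_1 + N_2 modulo 2; self-duality
   forces N_1 to be even, and the Lee or the Hamming weight decides.

   The structure of L* / L comes from the relations that the integrality of the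
   pairings with the basis vectors imposes, modulo 1, on the coefficients of a
   vector of L*. The glue vectors are combinations of fundamental weights. Such
   a weight pairs to 1 with a single basis vector and to 0 with the others, so
   that its norm is one of its own coefficients. *)

(** * Lattices as subgroups with integral pairings *)

Section DotProduct.
Context {R : realType} {W : vectType R} (b : {dot W for idfun}).
Implicit Types (x y : W).

Lemma dotC x y : b x y = b y x.
Proof. by rewrite hermC expr0 mul1r. Qed.

Lemma dotZl k x y : b (k *: x) y = k * b x y.
Proof. exact: linearZl_LR. Qed.

Lemma dotZr k x y : b x (k *: y) = k * b x y.
Proof. by rewrite dotC dotZl dotC. Qed.

Lemma dot0l y : b 0 y = 0.
Proof. exact: linear0l. Qed.

Lemma dot0r x : b x 0 = 0.
Proof. exact: linear0r. Qed.

Lemma dotDl x x' y : b (x + x') y = b x y + b x' y.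
Proof. exact: linearDl. Qed.

Lemma dotDr x y y' : b x (y + y') = b x y + b x y'.
Proof. exact: linearDr. Qed.

Lemma dotNl x y : b (- x) y = - b x y.
Proof. exact: linearNl. Qed.

Lemma dotBl x x' y : b (x - x') y = b x y - b x' y.
Proof. exact: linearBl. Qed.

Lemma dotBr x y y' : b x (y - y') = b x y - b x y'.
Proof. exact: linearBr. Qed.

Lemma dot_suml (I : Type) (r : seq I) (P : pred I) (F : I -> W) y :
  b (\sum_(i <- r | P i) F i) y = \sum_(i <- r | P i) b (F i) y.
Proof. exact: linear_sumlz. Qed.

Lemma dot_sumr (I : Type) (r : seq I) (P : pred I) (F : I -> W) x :
  b x (\sum_(i <- r | P i) F i) = \sum_(i <- r | P i) b x (F i).
Proof. exact: linear_sumr. Qed.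

Lemma dotMz x y (k : int) : b (x *~ k) y = b x y *~ k.
Proof. by rewrite -scaler_int dotZl mulrzl. Qed.

Lemma dot_eq0 x : b x x = 0 -> x = 0.
Proof.
by move=> xx0; apply/eqP; apply/contraT => /(@neq0_dnorm_gt0 _ _ _ b);
  rewrite xx0 ltxx.
Qed.

Lemma dot_spanr x (s : seq W) :
  {in s, forall y, b x y = 0} -> {in <<s>>%VS, forall y, b x y = 0}.
Proof.
move=> xs0 y /(@coord_span _ _ _ (in_tuple s)) ->.
rewrite dot_sumr big1 // => i _.
by rewrite dotZr xs0 ?mulr0 // mem_nth.
Qed.

End DotProduct.

Section Subgroups.
Context {R : realType} {W : vectType R}.
Implicit Types (b : {dot W for idfun}) (M : set W).
Local Open Scope classical_set_scope.

Definition subgroup M := M 0 /\ forall x y, M x -> M y -> M (x - y).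

Lemma subgroup0 M : subgroup M -> M 0.
Proof. by case. Qed.

Lemma subgroupB M x y : subgroup M -> M x -> M y -> M (x - y).
Proof. by case=> _; apply. Qed.

Lemma subgroupN M x : subgroup M -> M x -> M (- x).
Proof. by move=> sM Mx; rewrite -sub0r; apply: subgroupB => //; exact: subgroup0. Qed.

Lemma subgroupD M x y : subgroup M -> M x -> M y -> M (x + y).
Proof.
by move=> sM Mx My; rewrite -[y]opprK; apply: subgroupB => //; exact: subgroupN.
Qed.

Lemma subgroupMz M x (k : int) : subgroup M -> M x -> M (x *~ k).
Proof.
move=> sM Mx; have Mn (n : nat) : M (x *+ n).
  elim: n => [|n IHn]; first by rewrite mulr0n; exact: subgroup0.
  by rewrite mulrS; apply: subgroupD.
by case: k => n; [exact: Mn | rewrite NegzE mulrNz; apply: subgroupN; last exact: Mn].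
Qed.

Lemma subgroup_sum M (I : Type) (r : seq I) (P : pred I) (F : I -> W) :
  subgroup M -> (forall i, P i -> M (F i)) -> M (\sum_(i <- r | P i) F i).
Proof.
move=> sM MF; apply: big_ind => //; first exact: subgroup0.
by move=> x y; apply: subgroupD.
Qed.

Lemma subgroup_Zspan r (e : r.-tuple W) : subgroup [set x | inIntSpan e x].
Proof.
split=> [|x y [k ->] [l ->]].
  by exists [ffun=> 0]; rewrite big1 // => i _; rewrite ffunE.
exists [ffun i => k i - l i]; rewrite -sumrB; apply: eq_bigr => i _.
by rewrite ffunE mulrzBr.
Qed.

(** The family s is a finite set of linear forms that take integral values on M
   and separate its points, which is the discreteness needed for a Z-basis. The
   induction is on s: the values of one form on M are the multiples of some d,
   and a Z-basis of the kernel of that form on M is completed by an element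
   where the form takes the value d. *)
Lemma is_lattice_of_integral_pairing b M (s : seq W) :
  subgroup M ->
  (forall x, M x -> {in s, forall y, b x y \is a Num.int}) ->
  (forall x, M x -> {in s, forall y, b x y = 0} -> x = 0) ->
  is_lattice M.
Proof.
elim: s M => [|y s IHs] M sM Mint Minj.
  exists 0%N, [tuple]; split; first exact: nil_free.
  apply/seteqP; split=> x.
    by move=> /Minj -> //; exists [ffun=> 0]; rewrite big_ord0.
  by move=> [k ->]; rewrite big_ord0; exact: subgroup0.
pose M' := [set x | M x /\ b x y = 0].
have sM' : subgroup M'.
  split=> [|x z [Mx xy0] [Mz zy0]]; first by split; [exact: subgroup0|rewrite dot0l].
  by split; [exact: subgroupB|rewrite dotBl xy0 zy0 subrr].
have [|| r [g [g_free M'E]]] := IHs M' sM'.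
- by move=> x [Mx _] z zs; apply: Mint => //; rewrite inE zs orbT.
- move=> x [Mx xy0] xs0; apply: Minj => // z; rewrite inE => /orP[/eqP->//|].
  exact: xs0.
have [all0|/existsNP[x0 /not_implyP[Mx0 x0y]]] :=
    pselect (forall x, M x -> b x y = 0).
  exists r, g; split=> //; rewrite -M'E; apply/seteqP; split=> x //; last by case.
  by move=> Mx; split=> //; exact: all0.
(* The values b x y for x in M form a nonzero subgroup of the integers; d is
   its positive generator and x is an element of M reaching it. *)
pose P d := (0 < d)%N && `[< exists2 x, M x & b x y = d%:R >].
have exP : exists d, P d.
  have /intrP[k kE] : b x0 y \is a Num.int by apply: Mint; rewrite ?mem_head.
  have k_neq0 : k != 0 by apply/eqP => k0; apply: x0y; rewrite kE k0.
  exists `|k|%N; rewrite /P absz_gt0 k_neq0; apply/asboolP.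
  case: k kE k_neq0 => n kE _; first by exists x0.
  by exists (- x0); [exact: subgroupN | rewrite dotNl kE NegzE mulrNz opprK].
have [d /andP[d_gt0 /asboolP[x Mx xy]] d_min] := ex_minnP exP.
have reduce z : M z -> exists q : int, M' (z - x *~ q).
  move=> Mz; have /intrP[k kE] : b z y \is a Num.int.
    by apply: Mint; rewrite ?mem_head.
  exists (k %/ d)%Z; have Mw : M (z - x *~ (k %/ d)%Z).
    by apply: subgroupB => //; apply: subgroupMz.
  split=> //; have wE : b (z - x *~ (k %/ d)%Z) y = (k %% d)%Z%:~R.
    by rewrite dotBl dotMz kE xy -(mulrzr d%:R) /modz rmorphB rmorphM /= mulrC.
  rewrite wE; have := modz_ge0 k (lt0n_neq0 d_gt0 : d%:Z != 0).
  have := ltz_pmod k (d_gt0 : 0 < d%:Z).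
  case: (k %% d)%Z wE => // c wE; rewrite ltz_nat => c_lt_d _.
  case: c wE c_lt_d => // c wE c_lt_d; suff : (d <= c.+1)%N by rewrite leqNgt c_lt_d.
  by apply: d_min; rewrite /P /=; apply/asboolP; eexists; eassumption.
exists r.+1, [tuple of x :: g]; split.
  rewrite free_cons g_free andbT; apply/negP => x_in_g.
  suff : b x y = 0 by rewrite xy => /eqP; rewrite pnatr_eq0 eqn0Ngt d_gt0.
  rewrite dotC; apply: dot_spanr x_in_g => z /tnthP[i ->]; rewrite dotC.
  have [] : M' (tnth g i); last by [].
  rewrite M'E; exists [ffun j => (j == i)%:Z].
  rewrite (bigD1 i) //= ffunE eqxx mulr1z (tnth_nth 0) big1 ?addr0 // => j ji.
  by rewrite ffunE (negPf ji) mulr0z.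
apply/seteqP; split=> z; last first.
  move=> [k ->]; apply: subgroup_sum => // i _; apply: subgroupMz => //.
  case: (unliftP ord0 i) => [j|] -> //=.
  have [] : M' g`_j; last by [].
  rewrite M'E; exists [ffun l => (l == j)%:Z].
  rewrite (bigD1 j) //= ffunE eqxx mulr1z big1 ?addr0 // => l lj.
  by rewrite ffunE (negPf lj) mulr0z.
move=> /reduce[q]; rewrite M'E => -[k zE].
exists [ffun i => if unlift ord0 i is Some j then k j else q].
rewrite big_ord_recl /= ffunE unlift_none -[LHS](subrK (x *~ q)) zE addrC.
by congr (_ + _); apply: eq_bigr => i _; rewrite ffunE liftK.
Qed.

End Subgroups.

(** * The dual of a lattice with a given basis *)

Section Zbasis.
Context {R : realType} {V : vectType R} (b : {dot V for idfun}) (L : set V).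
Context {n : nat} (e : n.-tuple V) (Le : is_Zbasis L e).

Lemma Zbasis_subgroup : subgroup L.
Proof. by rewrite Le.2; exact: subgroup_Zspan. Qed.

Lemma Zbasis_mem i : L (tnth e i).
Proof.
rewrite Le.2; exists [ffun j => (j == i)%:Z].
rewrite (bigD1 i) //= ffunE eqxx mulr1z (tnth_nth 0) big1 ?addr0 // => j ji.
by rewrite ffunE (negPf ji) mulr0z.
Qed.

Lemma Zbasis_ind (P : V -> Prop) :
  P 0 -> (forall x i k, L x -> P x -> P (x + tnth e i *~ k)) ->
  forall x, L x -> P x.
Proof.
move=> P0 PD x; rewrite {1}Le.2 => -[k ->].
suff [//] : L (\sum_(i < n) e`_i *~ k i) /\ P (\sum_(i < n) e`_i *~ k i).
elim/big_rec: _ => [|i y _ [Ly Py]].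
  by split=> //; exact: subgroup0 Zbasis_subgroup.
rewrite addrC -tnth_nth; split; last exact: PD.
apply: subgroupD => //; first exact: Zbasis_subgroup.
by apply: subgroupMz; [exact: Zbasis_subgroup | exact: Zbasis_mem].
Qed.

Lemma real_span_Zbasis x : real_span L x <-> x \in <<e>>%VS.
Proof.
split=> [[s sL] | x_e].
  apply/subvP/span_subvP => y /sL; rewrite Le.2 => -[k ->].
  apply: rpred_sum => i _; apply: rpredMz; apply: memv_span.
  by rewrite mem_nth ?size_tuple.
by exists e => // y /tnthP[i ->]; exact: Zbasis_mem.
Qed.

Lemma dual_lattice_Zbasis x :
  dual_lattice b L x <->
  x \in <<e>>%VS /\ forall i, b x (tnth e i) \is a Num.int.
Proof.
split=> [[/real_span_Zbasis x_e xL] | [x_e xe]].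
  by split=> // i; apply: xL; exact: Zbasis_mem.
split; first exact/real_span_Zbasis.
apply: Zbasis_ind => [|y i k _ xy]; first by rewrite dot0r.
by rewrite dotDr rpredD // dotC dotMz rpredMz // dotC.
Qed.

Lemma dual_subgroup : subgroup (dual_lattice b L).
Proof.
split=> [|x y]; rewrite !dual_lattice_Zbasis.
  by split=> [|i]; [exact: mem0v | rewrite dot0l].
move=> [x_e xe] [y_e ye]; split=> [|i]; first exact: rpredB.
by rewrite dotBl rpredB.
Qed.

Lemma dual_dot_eq0 x : dual_lattice b L x ->
  (forall i, b x (tnth e i) = 0) -> x = 0.
Proof.
move=> /dual_lattice_Zbasis[x_e _] xe0; apply: (@dot_eq0 _ _ b).
by apply: dot_spanr x_e => y /tnthP[i ->].
Qed.

Lemma even_lattice_Zbasis :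
  (forall i j, b (tnth e i) (tnth e j) \is a Num.int) ->
  (forall i, b (tnth e i) (tnth e i) = 2) -> even_lattice b L.
Proof.
move=> eint e2; have Lint : integral b L.
  move=> x y Lx; move: y; apply: Zbasis_ind => [|y j k _ xy].
    by rewrite dot0r.
  rewrite dotDr rpredD // dotC dotMz rpredMz // dotC.
  move: x Lx {y k xy}; apply: Zbasis_ind => [|x i k _ xy].
    by rewrite dot0l rpred0.
  by rewrite dotDl rpredD // dotMz rpredMz.
split=> //; apply: Zbasis_ind => [|x i k Lx [l xx]].
  by exists 0; rewrite dot0l mulr0.
have /intrP[c cE] := Lint _ _ Lx (Zbasis_mem i).
have xy : b x (tnth e i *~ k) = (c * k)%:~R.
  by rewrite dotC dotMz dotC cE -mulrzA.
have yy : b (tnth e i *~ k) (tnth e i *~ k) = (2 * (k * k))%:~R.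
  by rewrite dotMz dotC dotMz e2 -mulrzA -(mulrzr (2 : R)) [in RHS]intrM.
exists (l + c * k + k * k); rewrite dotDl !dotDr xx xy dotC xy yy -!intrD.
by congr (_%:~R); ring.
Qed.

End Zbasis.

(** * Gluing copies of a lattice along a code *)

(** The glue vectors gl s represent the classes of L* / L and identify this
   quotient with the additive group of S; chi is a real-valued lift of the
   character of S through which the form of L* factors modulo the integers. *)
Record glue_system {R : realType} {V : vectType R} (b : {dot V for idfun})
    (L : set V) (S : finComNzRingType) (gl : S -> V) (chi : S -> R) : Prop := {
  glue_dual : forall s, dual_lattice b L (gl s);
  glueD : forall s t, L (gl (s + t) - gl s - gl t);
  glue_onto : forall x, dual_lattice b L x -> exists s, L (x - gl s);
  charD : forall s t, chi (s + t) - chi s - chi t \is a Num.int;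
  glue_char : forall s t, b (gl s) (gl t) - chi (s * t) \is a Num.int;
  char_nondeg : forall s, (forall t, chi (s * t) \is a Num.int) -> s = 0 }.

Lemma even_intP (R : realType) (x : R) :
  (exists k : int, x = (2 * k)%:~R) <-> x / 2 \is a Num.int.
Proof.
split=> [[k ->]|/intrP[k xk]].
  by apply/intrP; exists k; rewrite intrM mulrAC mulfV ?mul1r ?pnatr_eq0.
by exists k; rewrite intrM -xk mulrC mulfVK ?pnatr_eq0.
Qed.

Section Gluing.
Context {R : realType} {V : vectType R} (b : {dot V for idfun}) (L : set V).
Context {n : nat} (e : n.-tuple V) (Le : is_Zbasis L e).
Context (Leven : even_lattice b L).
Context {S : finComNzRingType} (gl : S -> V) (chi : S -> R).
Context (glue : glue_system b L gl chi).

Let sL : subgroup L := Zbasis_subgroup Le.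
Let dL := dual_lattice b L.

Lemma dual_intl x l : dL x -> L l -> b x l \is a Num.int.
Proof. by case=> _; apply. Qed.

Lemma lattice_dual l : L l -> dL l.
Proof.
move=> Ll; split; last by move=> y Ly; exact: Leven.1.
by exists [:: l] => [y|]; rewrite ?memv_span1 // inE => /eqP->.
Qed.

(** Distinct letters have distinct classes because the discriminant form is
   nondegenerate: a glue vector in L pairs integrally with all the others. *)
Lemma glue_inj s : L (gl s) -> s = 0.
Proof.
move=> Ls; apply: (char_nondeg glue) => t.
rewrite -[chi _](subKr (b (gl s) (gl t))) rpredB //.
  by rewrite dotC dual_intl //; exact: glue_dual glue t.
exact: glue_char glue s t.
Qed.

Lemma glueB s t : L (gl s - gl t - gl (s - t)).
Proof. by have := glueD glue (s - t) t; rewrite subrK addrAC. Qed.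

Lemma glue_reduction : exists rho : V -> S, forall x, dL x -> L (x - gl (rho x)).
Proof.
suff /choice[rho rhoP] : forall x, exists s, dL x -> L (x - gl s) by exists rho.
move=> x; have [/(glue_onto glue)[s xs]|ndx] := pselect (dL x); first by exists s.
by exists 0.
Qed.

Context (rho : V -> S) (rhoP : forall x, dL x -> L (x - gl (rho x))).

Lemma rho_unique x s : dL x -> L (x - gl s) -> rho x = s.
Proof.
move=> /rhoP xr xs; apply/eqP; rewrite -subr_eq0; apply/eqP/glue_inj.
have -> : gl (rho x - s) = (x - gl s) - (x - gl (rho x))
                         - (gl (rho x) - gl s - gl (rho x - s)).
  by rewrite [x - gl s]addrC addrKA opprK [- _ + _]addrC subKr.
apply: subgroupB (glueB _ _) => //; exact: subgroupB.
Qed.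


Lemma rho_glue s : rho (gl s) = s.
Proof.
apply: rho_unique; first exact: glue_dual glue s.
by rewrite subrr; exact: subgroup0.
Qed.

Lemma rhoB x y : dL x -> dL y -> rho (x - y) = rho x - rho y.
Proof.
move=> dx dy; apply: rho_unique; first exact: subgroupB (dual_subgroup b Le) _ _.
have -> : x - y - gl (rho x - rho y) = (x - gl (rho x)) - (y - gl (rho y))
    + (gl (rho x) - gl (rho y) - gl (rho x - rho y)).
  rewrite addrA; congr (_ - _).
  by rewrite [RHS]addrAC subrKA opprB subrKA.
apply: subgroupD (glueB _ _) => //; apply: subgroupB (rhoP dx) (rhoP dy); exact: sL.
Qed.

Lemma rho_lattice l : L l -> rho l = 0.
Proof.
move=> Ll; apply: rho_unique; first exact: lattice_dual.
apply: subgroupB => //; have := glueD glue 0 0.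
by rewrite addr0 subrr sub0r => /(subgroupN sL); rewrite opprK.
Qed.

Lemma rho_pairing x y : dL x -> dL y ->
  b x y - chi (rho x * rho y) \is a Num.int.
Proof.
move=> dx dy; pose u := gl (rho x); pose v := gl (rho y).
have -> : b x y - chi (rho x * rho y) =
    b y (x - u) + b u (y - v) + (b u v - chi (rho x * rho y)).
  by rewrite dotBr dotBr (dotC b y) (dotC b y); ring.
apply: rpredD (glue_char glue _ _); apply: rpredD; apply: dual_intl => //.
- exact: rhoP.
- exact: glue_dual glue _.
- exact: rhoP.
Qed.

Lemma rho_norm x : dL x ->
  (b x x - b (gl (rho x)) (gl (rho x))) / 2 \is a Num.int.
Proof.
move=> dx; pose u := gl (rho x).
have /even_intP le := Leven.2 _ (rhoP dx).
have -> : (b x x - b u u) / 2 = b (x - u) (x - u) / 2 + b u (x - u).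
  by rewrite !dotBl !dotBr (dotC b x u); field.
by apply: rpredD le _; apply: dual_intl (rhoP dx); exact: glue_dual glue _.
Qed.

(** Modulo the integers chi is additive, so congruences may be summed. *)
Lemma char_sum (I : Type) (r : seq I) (F : I -> S) (G : I -> R) :
  (forall i, G i - chi (F i) \is a Num.int) ->
  \sum_(i <- r) G i - chi (\sum_(i <- r) F i) \is a Num.int.
Proof.
move=> GF; elim: r => [|i r IHr].
  by rewrite !big_nil sub0r; have := charD glue 0 0; rewrite addr0 subrr sub0r.
rewrite !big_cons; set s := \sum_(j <- r) F j; set t := \sum_(j <- r) G j.
have -> : G i + t - chi (F i + s) =
    (G i - chi (F i)) + (t - chi s) - (chi (F i + s) - chi (F i) - chi s) by ring.
by apply: rpredB (charD glue _ _); apply: rpredD.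
Qed.


Section Power.
Context (m : nat).
Implicit Types (x y : {ffun 'I_m -> V}) (C : {set 'rV[S]_m}).
Let B := @power_form R V b m.

Lemma power_form_int x y : (forall i, dL (x i)) -> (forall i, dL (y i)) ->
  (B x y \is a Num.int) =
  (chi (\sum_i map_power rho x 0 i * map_power rho y 0 i) \is a Num.int).
Proof.
move=> dx dy; set s := \sum_i _.
have Bs : B x y - chi s \is a Num.int.
  by apply: char_sum => i; rewrite !mxE; exact: rho_pairing.
by rewrite -[B x y](subrK (chi s)) rpredDl.
Qed.

Lemma power_norm x : (forall i, dL (x i)) ->
  let c := map_power rho x in
  (B x x / 2 \is a Num.int) =
  ((\sum_i b (gl (c 0 i)) (gl (c 0 i))) / 2 \is a Num.int).
Proof.
move=> dx c; set N := \sum_i _.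
rewrite -[B x x](subrK N) mulrDl rpredDl // -sumrB mulr_suml.
by apply: rpred_sum => i _; rewrite !mxE; exact: rho_norm.
Qed.

Definition supported_at (i : 'I_m) (v : V) : {ffun 'I_m -> V} :=
  [ffun k => if k == i then v else 0].

Lemma power_form_supported x i v : B x (supported_at i v) = b (x i) v.
Proof.
rewrite /B /power_form (bigD1 i) //= ffunE eqxx big1 ?addr0 // => j ji.
by rewrite ffunE (negPf ji) dot0r.
Qed.

Lemma ffun_supported_sum x : x = \sum_i supported_at i (x i).
Proof.
apply/ffunP => k; rewrite sum_ffunE (bigD1 k) //= ffunE eqxx big1 ?addr0 //.
by move=> j jk; rewrite ffunE eq_sym (negPf jk).
Qed.

Lemma supported_Gamma C i l : is_code C -> L l ->
  Gamma b L rho C (supported_at i l).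
Proof.
move=> codeC Ll; split=> [k|].
  rewrite ffunE; case: ifP => _; first exact: lattice_dual.
  exact: subgroup0 (dual_subgroup b Le).
have -> : map_power rho (supported_at i l) = 0; last exact: codeC.1.
apply/rowP => k; rewrite !mxE ffunE; case: ifP => _; rewrite rho_lattice //.
exact: subgroup0.
Qed.

(** Gamma contains the copies of L, which already span all the coordinates. *)
Lemma real_span_Gamma C x : is_code C ->
  (forall i, dL (x i)) -> real_span (Gamma b L rho C) x.
Proof.
move=> codeC dx.
exists [seq supported_at p.1 (tnth e p.2) | p : 'I_m * 'I_n].
  by move=> y /mapP[p _ ->]; apply: supported_Gamma => //; exact: Zbasis_mem.
rewrite (ffun_supported_sum x); apply: rpred_sum => i _.
have /(dual_lattice_Zbasis b Le)[xi_e _] := dx i.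
rewrite {1}(coord_span xi_e).
have -> : supported_at i (\sum_j coord e j (x i) *: e`_j) =
    \sum_j coord e j (x i) *: supported_at i (tnth e j).
  apply/ffunP => k; rewrite sum_ffunE ffunE; case: ifP => ki.
    by apply: eq_bigr => j _; rewrite !ffunE ki (tnth_nth 0).
  by rewrite big1 // => j _; rewrite !ffunE ki scaler0.
apply: rpred_sum => j _; apply: rpredZ; apply: memv_span.
by apply/mapP; exists (i, j); rewrite ?mem_enum.
Qed.

(** The vectors of the basis of L, placed at the various coordinates, pair
   integrally with Gamma and separate its points. *)
Lemma Gamma_lattice C : is_code C -> is_lattice (Gamma b L rho C).
Proof.
move=> codeC.
pose s := [seq supported_at p.1 (tnth e p.2) | p : 'I_m * 'I_n].
apply: (@is_lattice_of_integral_pairing _ _ (@power_form R V b m) _ s).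
- have dsub := dual_subgroup b Le; split=> [|x y [dx Cx] [dy Cy]].
    split=> [i|]; first by rewrite ffunE; exact: subgroup0.
    have -> : map_power rho (0 : {ffun 'I_m -> V}) = 0; last exact: codeC.1.
    by apply/rowP => i; rewrite !mxE ffunE rho_lattice //; exact: subgroup0.
  split=> [i|]; first by rewrite !ffunE; exact: subgroupB.
  have -> : map_power rho (x - y) = (-1) *: map_power rho y + map_power rho x.
    by apply/rowP => i; rewrite !mxE !ffunE (rhoB (dx i) (dy i)) mulN1r addrC.
  exact: codeC.2.
- move=> x [dx _] y /mapP[[i j] _ ->] /=.
  have /(dual_lattice_Zbasis b Le)[_ /(_ j)] := dx i.
  by rewrite -power_form_supported.
- move=> x [dx _] x0; apply/ffunP => i; rewrite ffunE.
  apply: (dual_dot_eq0 Le (dx i)) => j; rewrite -power_form_supported; apply: x0.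
  by apply/mapP; exists (i, j); rewrite ?mem_enum.
Qed.

(** Orthogonality may be tested through chi alone: a code is stable under
   scalars, so the products c . y form an ideal of S, and chi is integral on no
   nonzero ideal. *)
Lemma dual_code_char C (c : 'rV[S]_m) : is_code C ->
  c \in dual_code C <->
  forall y : 'rV[S]_m, y \in C -> chi (\sum_i c 0 i * y 0 i) \is a Num.int.
Proof.
move=> codeC; rewrite inE; split=> [/forall_inP cC y /cC/eqP ->|cC].
  by have := charD glue 0 0; rewrite addr0 subrr sub0r rpredN.
apply/forall_inP => y yC; apply/eqP; apply: (char_nondeg glue) => t.
have tyC : t *: y \in C.
  by rewrite -[_ *: _]addr0; apply: codeC.2 => //; exact: codeC.1.
suff -> : (\sum_i c 0 i * y 0 i) * t = \sum_i c 0 i * (t *: y) 0 i by exact: cC.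
by rewrite mulr_suml; apply: eq_bigr => i _; rewrite mxE -mulrA [y 0 i * t]mulrC.
Qed.

Lemma map_power_onto (c : 'rV[S]_m) :
  exists2 x : {ffun 'I_m -> V}, forall i, dL (x i) & map_power rho x = c.
Proof.
exists [ffun i => gl (c 0 i)] => [i|]; first by rewrite ffunE; exact: glue_dual glue _.
by apply/rowP => i; rewrite mxE ffunE rho_glue.
Qed.

(** The dual of Gamma has coordinates in L* since Gamma contains the copies of
   L; on such vectors the form is the product of codewords followed by chi. *)
Lemma dual_Gamma C : is_code C ->
  dual_lattice (@power_form R V b m) (Gamma b L rho C) =
  Gamma b L rho (dual_code C).
Proof.
move=> codeC; apply/seteqP; split=> x [].
  move=> [s sG x_s] xG; have dx i : dL (x i).
    split.
      apply/(real_span_Zbasis Le).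
      have -> : x i = \sum_(j < size s) coord (in_tuple s) j x *: s`_j i.
        rewrite {1}(coord_span (X := in_tuple s) x_s) sum_ffunE.
        by apply: eq_bigr => j _; rewrite ffunE.
      apply: rpred_sum => j _; apply: rpredZ.
      have [dsj _] := sG _ (mem_nth 0 (ltn_ord j)).
      by have /(dual_lattice_Zbasis b Le)[] := dsj i.
    move=> l Ll; rewrite -power_form_supported; apply: xG.
    exact: supported_Gamma.
  split=> //; apply/dual_code_char => // c cC.
  have [y dy yc] := map_power_onto c.
  have := xG y; rewrite power_form_int // yc; apply; split=> //.
  by rewrite yc.
move=> dx xC; split=> [|y [dy yC]]; first exact: real_span_Gamma.
rewrite power_form_int //; have /dual_code_char := xC; exact.
Qed.

Lemma even_unimodular_Gamma C : is_code C ->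
  even_unimodular (@power_form R V b m) (Gamma b L rho C) <->
  self_dual C /\ forall c, c \in C ->
    (\sum_i b (gl (c 0 i)) (gl (c 0 i))) / 2 \is a Num.int.
Proof.
move=> codeC; rewrite /even_unimodular /unimodular dual_Gamma //; split.
  move=> [[_ Geven] GE]; split.
    apply/setP => c; have [x dx <-] := map_power_onto c.
    have GxE : Gamma b L rho (dual_code C) x = Gamma b L rho C x by rewrite GE.
    by apply/idP/idP => xC; [suff [] : Gamma b L rho C x by []; rewrite -GxE
      | suff [] : Gamma b L rho (dual_code C) x by []; rewrite GxE].
  move=> c cC; have [x dx xc] := map_power_onto c; rewrite -xc -power_norm //.
  by apply/even_intP/Geven; split=> //; rewrite xc.
move=> [Cdual Ceven]; rewrite Cdual; split=> //; split.
  move=> x y [dx xC] [dy yC]; rewrite power_form_int //.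
  have /(dual_code_char _ codeC) : map_power rho x \in dual_code C by rewrite Cdual.
  exact.
by move=> x [dx xC]; apply/even_intP; rewrite power_norm //; exact: Ceven.
Qed.

End Power.

End Gluing.

(** A single rho serves all codes over S of all lengths. *)
Theorem glue_even_unimodular {R : realType} {V : vectType R}
    (b : {dot V for idfun}) (L : set V) (n : nat) (e : n.-tuple V)
    (S : finComNzRingType) (gl : S -> V) (chi : S -> R) :
  is_Zbasis L e -> even_lattice b L -> glue_system b L gl chi ->
  exists rho : V -> S, forall (m : nat) (C : {set 'rV[S]_m}), is_code C ->
    is_lattice (Gamma b L rho C) /\
    (even_unimodular (@power_form R V b m) (Gamma b L rho C) <->
     self_dual C /\ forall c, c \in C ->
       (\sum_i b (gl (c 0 i)) (gl (c 0 i))) / 2 \is a Num.int).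
Proof.
move=> Le Leven glue; have [rho rhoP] := glue_reduction glue.
exists rho => m C codeC; split; first exact: (Gamma_lattice Le Leven glue rhoP).
exact: (even_unimodular_Gamma Le Leven glue rhoP).
Qed.

(** * Cyclic discriminant groups *)

Lemma natr_div_int (R : realType) (a d : nat) : (0 < d)%N ->
  (a%:R / d%:R \is a @Num.int R) = (d %| a)%N.
Proof.
move=> d_gt0; have d_neq0 : d%:R != 0 :> R by rewrite pnatr_eq0 -lt0n.
apply/idP/dvdnP => [/intrP[k /(canRL (mulfVK d_neq0)) adk]|[k ->]]; last first.
  by rewrite natrM mulfK // natr_int.
have /eqP : a%:Z = k * d by apply: (@intr_inj R); rewrite rmorphM /= -adk.
case: k {adk} => k; first by rewrite -PoszM eqz_nat => /eqP ->; exists k.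
rewrite NegzE mulNr => /eqP ak; exists 0; lia.
Qed.

Section CyclicGlue.
Context {R : realType} {V : vectType R} (b : {dot V for idfun}) (L : set V).
Context {n : nat} (e : n.-tuple V) (Le : is_Zbasis L e).
Context (Leven : even_lattice b L).
Context (N q : nat) (g : V).
Hypothesis N_gt1 : (1 < N)%N.
Hypothesis g_dual : dual_lattice b L g.
Hypothesis g_order : L (g *+ N).
Hypothesis g_generates : forall x, dual_lattice b L x ->
  exists k : int, L (x - g *~ k).
Hypothesis g_norm : b g g = q%:R / N%:R.
Hypothesis q_coprime : coprime q N.

Definition multiple_of (s : 'Z_N) : V := g *+ s.

Lemma dot_multiple s t :
  b (multiple_of s) (multiple_of t) = (q * (s * t))%:R / N%:R.
Proof.
rewrite /multiple_of -!scaler_nat dotZl dotZr g_norm !natrM; ring.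
Qed.

(** The classes of multiples of g are indexed by residues because N g is in L.
   As b (g, g) = q / N, the form is q s t / N modulo 1, which depends only on
   the product s t in Z / N; it is nondegenerate because q is prime to N. *)
Lemma cyclic_glue_system :
  glue_system b L multiple_of (fun s : 'Z_N => (q * s)%:R / N%:R).
Proof.
have sL := Zbasis_subgroup Le; have N_neq0 : N%:R != 0 :> R.
  by rewrite pnatr_eq0 -lt0n ltnW.
have red (a : nat) :
    (q * (a %% N))%:R / N%:R = (q * a)%:R / N%:R - (q * (a %/ N))%:R :> R.
  rewrite {2}(divn_eq a N) !(natrM, natrD); field; exact: N_neq0.
have valE (a : nat) : (a %% (Zp_trunc N).+2 = a %% N)%N by rewrite Zp_cast.
split=> [s|s t|x dx|s t|s t|s s_char].
- rewrite /multiple_of pmulrn.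
  by apply: subgroupMz => //; exact: (dual_subgroup b Le).
- rewrite /multiple_of /= valE.
  have -> : g *+ ((s + t) %% N) - g *+ s - g *+ t = - ((g *+ N) *~ ((s + t) %/ N)%N).
    rewrite -addrA -opprD -mulrnDr {2}(divn_eq (s + t) N) mulrnDr -pmulrn -mulrnA mulnC.
    by rewrite opprD addrCA subrr addr0.
  by apply: subgroupN => //; apply: subgroupMz.
- have [k xk] := g_generates dx.
  have r_ge0 := modz_ge0 k (lt0n_neq0 (ltnW N_gt1) : N%:Z != 0).
  exists (`|(k %% N)%Z|%N)%:R; rewrite /multiple_of val_Zp_nat //.
  have -> : x - g *+ (`|(k %% N)%Z| %% N) =
      x - g *~ k + (g *+ N) *~ (k %/ N)%Z.
    rewrite modn_small; last first.
      by rewrite -ltz_nat gez0_abs // ltz_pmod // ltz_nat ltnW.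
    rewrite pmulrn gez0_abs // -addrA; congr (_ + _).
    have -> : g *~ k = (g *+ N) *~ (k %/ N)%Z + g *~ (k %% N)%Z.
      by rewrite (pmulrn g) -mulrzA mulrC -mulrzDr -divz_eq.
    by rewrite opprD addrAC addNr add0r.
  by apply: subgroupD => //; apply: subgroupMz.
- rewrite /= valE red natrM natrD mulrDr mulrDl -!natrM.
  set u := _ / _; set v := _ / _; set w := _%:R.
  have -> : u + v - w - u - v = - w by ring.
  by rewrite rpredN natr_int.
- rewrite dot_multiple /= valE red opprB addrC subrK natr_int //.
- have := s_char 1; rewrite mulr1 natr_div_int 1?ltnW // Gauss_dvdr 1?coprime_sym //.
  move=> Ns; apply/val_inj/eqP => /=; rewrite -[_ == _]negbK -lt0n.
  apply/negP => /dvdn_leq/(_ Ns); rewrite leqNgt => /negP; apply.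
  by rewrite -{2}(Zp_cast N_gt1).
Qed.

Lemma multiple_norm m (c : 'rV['Z_N]_m) :
  (\sum_i b (multiple_of (c 0 i)) (multiple_of (c 0 i))) / 2 \is a Num.int =
  (2 * N %| q * \sum_i c 0%R i ^ 2)%N.
Proof.
have N_gt0 : (0 < N)%N by exact: ltnW.
have N_neq0 : N%:R != 0 :> R by rewrite pnatr_eq0 -lt0n.
have -> : \sum_i b (multiple_of (c 0 i)) (multiple_of (c 0 i)) =
    (q * \sum_i c 0%R i ^ 2)%N%:R / N%:R.
  rewrite big_distrr natr_sum mulr_suml; apply: eq_bigr => i _.
  by rewrite dot_multiple mulnn.
rewrite -(natr_div_int R) ?muln_gt0 // [X in _ = (_ / X \is a _)]natrM.
by rewrite invfM [in RHS]mulrA [in LHS]mulrAC.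
Qed.
End CyclicGlue.

(** The zero letters are counted with the representative N rather than 0, which
   accounts for the second term. *)
Lemma euclidean_weightE (N m : nat) (c : 'rV['Z_N]_m) : (1 < N)%N ->
  euclidean_weight N c =
  (\sum_i c 0%R i ^ 2 + N ^ 2 * #|[set i : 'I_m | c 0%R i == 0%R]%SET|)%N.
Proof.
case: N c => [|[|N]] // c _; rewrite /euclidean_weight big_nat_recr //=.
congr (_ + _ * _)%N; last first.
  by rewrite /num_coord; apply: eq_card => i; rewrite !inE pchar_Zp.
rewrite -[RHS]/(\sum_i c 0%R i ^ 2)%N.
under eq_bigr => k _ do rewrite /num_coord -sum1dep_card big_distrr /= big_mkcond.
rewrite exchange_big /=; apply: eq_bigr => i _.
transitivity (\sum_(0 <= k < N.+2) if c 0%R i == k%:R%R then k ^ 2 * 1 else 0)%N.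
  by rewrite [RHS]big_ltn //; case: ifP.
rewrite big_mkord -big_mkcond (big_pred1 (c 0%R i)) ?muln1 // => k.
by rewrite natr_Zp eq_sym.
Qed.

(** For N even, 2 N divides N ^ 2, so the zero letters do not matter. *)
Lemma typeII_ZE (N m : nat) (C : {set 'rV['Z_N]_m}) : (1 < N)%N -> ~~ odd N ->
  typeII_Z N C <->
  self_dual C /\ forall c, c \in C -> (2 * N %| \sum_i c 0%R i ^ 2)%N.
Proof.
move=> N_gt1 N_even; have N2 : (2 * N %| N ^ 2)%N.
  by rewrite expnS expn1 dvdn_mul // dvdn2.
by split=> -[Cdual CII]; split=> // c /CII;
  rewrite euclidean_weightE // dvdn_addl // dvdn_mulr.
Qed.

Lemma self_dual_sum_sqr (N m : nat) (C : {set 'rV['Z_N]_m}) c : (1 < N)%N ->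
  self_dual C -> c \in C -> (N %| \sum_i c 0%R i ^ 2)%N.
Proof.
move=> N_gt1 Cdual cC.
have : c \in dual_code C by rewrite Cdual.
rewrite inE => /forall_inP/(_ _ cC)/eqP cc0.
have : (\sum_i c 0%R i ^ 2)%N%:R = 0 :> 'Z_N.
  by rewrite natr_sum -[RHS]cc0; apply: eq_bigr => i _; rewrite natrX natr_Zp expr2.
by move=> /(congr1 val) /=; rewrite val_Zp_nat // => /eqP.
Qed.

Section CyclicGlueCodes.
Context {R : realType} {V : vectType R} (b : {dot V for idfun}) (L : set V).
Context {n : nat} (e : n.-tuple V) (Le : is_Zbasis L e).
Context (Leven : even_lattice b L).
Context (N q : nat) (g : V).
Hypothesis N_gt1 : (1 < N)%N.
Hypothesis g_dual : dual_lattice b L g.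
Hypothesis g_order : L (g *+ N).
Hypothesis g_generates : forall x, dual_lattice b L x ->
  exists k : int, L (x - g *~ k).
Hypothesis g_norm : b g g = q%:R / N%:R.
Hypothesis q_coprime : coprime q N.

(** Here q is odd, hence prime to 2 N, and may be cancelled from q / N times the
   sum of the squares. *)
Lemma cyclic_glue_even m (C : {set 'rV['Z_N]_m}) : ~~ odd N -> is_code C ->
  even_unimodular_iff b L C (typeII_Z N C).
Proof.
move=> N_even codeC.
have glue := cyclic_glue_system Le N_gt1 g_dual g_order g_generates g_norm q_coprime.
have [rho rhoP] := glue_even_unimodular Le Leven glue.
exists rho; have [Glat GE] := rhoP m C codeC; split=> //.
rewrite GE typeII_ZE //; split=> -[Cdual CII]; split=> // c /CII.
  rewrite (multiple_norm N_gt1 g_norm) Gauss_dvdr //.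
  have q_odd : odd q by rewrite -coprimen2 (coprime_dvdr _ q_coprime) // dvdn2.
  by rewrite coprimeMl coprime2n q_odd coprime_sym.
rewrite (multiple_norm N_gt1 g_norm); exact: dvdn_mull.
Qed.

(** Here evenness is automatic: N divides the sum of the squares and 2
   divides q. *)
Lemma cyclic_glue_odd m (C : {set 'rV['Z_N]_m}) : odd N -> ~~ odd q ->
  is_code C -> even_unimodular_iff b L C (self_dual C).
Proof.
move=> N_odd q_even codeC.
have glue := cyclic_glue_system Le N_gt1 g_dual g_order g_generates g_norm q_coprime.
have [rho rhoP] := glue_even_unimodular Le Leven glue.
exists rho; have [Glat GE] := rhoP m C codeC; split=> //.
rewrite GE; split=> [[] // | Cdual]; split=> // c cC.
rewrite (multiple_norm N_gt1 g_norm) dvdn_mul ?dvdn2 //.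
exact: self_dual_sum_sqr cC.
Qed.

End CyclicGlueCodes.

(** * Discriminant groups isomorphic to Klein's four-group *)

Section F2uF2Coordinates.
Implicit Types x y : F2uF2.

Definition fcoef (i : nat) x : 'F_2 := (x : {poly 'F_2})`_i.

Lemma fcoefD i x y : fcoef i (x + y) = fcoef i x + fcoef i y.
Proof. by rewrite /fcoef /= coefD. Qed.

Lemma F2uF2_modulus : mk_monic ('X^2 : {poly 'F_2}) = 'X^2.
Proof. exact: mk_monic_Xn. Qed.

Lemma size_F2uF2 x : (size (x : {poly 'F_2}) <= 2)%N.
Proof.
have sz : size (mk_monic ('X^2 : {poly 'F_2})) = 3%N.
  by rewrite F2uF2_modulus size_polyXn.
by rewrite -ltnS -[X in (_ < X)%N]sz; exact: size_mk_monic.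
Qed.

Lemma F2uF2P x y : fcoef 0 x = fcoef 0 y -> fcoef 1 x = fcoef 1 y -> x = y.
Proof.
move=> xy0 xy1; apply/val_inj/polyP => -[|[|i]] //.
by rewrite !nth_default // (leq_trans (size_F2uF2 _)).
Qed.

Lemma fcoefM x y :
  (fcoef 0 (x * y) = fcoef 0 x * fcoef 0 y) *
  (fcoef 1 (x * y) = fcoef 0 x * fcoef 1 y + fcoef 1 x * fcoef 0 y).
Proof.
have mulE : ((x * y : F2uF2) : {poly 'F_2}) =
    take_poly 2 ((x : {poly 'F_2}) * (y : {poly 'F_2})).
  rewrite /=; set p := (_ * _)%R; rewrite F2uF2_modulus.
  rewrite -{1}(poly_take_drop 2 p) addrC.
  rewrite Pdiv.RingMonic.rmodp_addl_mul_small ?monicXn //.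
  by rewrite size_polyXn ltnS size_take_poly.
rewrite /fcoef mulE !coef_take_poly /= !coefM !big_ord_recl !big_ord0 /=.
by rewrite !addr0.
Qed.

Lemma fcoef_u : (fcoef 0 F2u = 0) * (fcoef 1 F2u = 1).
Proof.
have uE : (F2u : {poly 'F_2}) = 'X by rewrite qpolyXE ?size_polyXn ?monicXn.
by rewrite /fcoef uE !coefX.
Qed.

Lemma fcoef1 : (fcoef 0 1 = 1) * (fcoef 1 1 = 0).
Proof. by rewrite /fcoef !coefC. Qed.

Lemma fcoef0 : (fcoef 0 0 = 0) * (fcoef 1 0 = 0).
Proof. by rewrite /fcoef !coef0. Qed.

End F2uF2Coordinates.

Lemma F2uF2_coordinates (a c : 'F_2) : exists x, fcoef 0 x = a /\ fcoef 1 x = c.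
Proof.
have F2P (d : 'F_2) : d = 0 \/ d = 1.
  by case: d => -[|[|//]] d_lt; [left | right]; exact: val_inj.
have [-> | ->] := F2P a; have [-> | ->] := F2P c.
- by exists 0; rewrite !fcoef0.
- by exists F2u; rewrite !fcoef_u.
- by exists 1; rewrite !fcoef1.
- by exists (1 + F2u); rewrite !fcoefD !fcoef1 !fcoef_u addr0 add0r.
Qed.

Lemma F2_natD (a c : 'F_2) : exists k, (a + c = (a + c)%R + 2 * k)%N.
Proof. by exists ((a + c) %/ 2)%N; rewrite {1}(divn_eq (a + c) 2) addnC mulnC. Qed.

Lemma F2_natM (a c : 'F_2) : (a * c)%R = (a * c)%N :> nat.
Proof. by case: a c => -[|[|//]] ? [[|[|//]] ?]. Qed.

Lemma eq_F2uF2 x y :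
  (x == y) = (fcoef 0 x == fcoef 0 y) && (fcoef 1 x == fcoef 1 y).
Proof.
apply/eqP/andP => [->|[/eqP xy0 /eqP xy1]]; first by rewrite !eqxx.
exact: F2uF2P.
Qed.

Lemma N2E m (c : 'rV[F2uF2]_m) : N2 c = (\sum_i (c 0%R i == F2u))%N.
Proof. by rewrite /N2 -sum1dep_card big_mkcond. Qed.

Lemma N1E m (c : 'rV[F2uF2]_m) : N1 c = (\sum_i fcoef 0 (c 0%R i))%N.
Proof.
have total : (\sum_i fcoef 0 (c 0%R i) + N2 c + N0 c = m)%N.
  rewrite N2E /N0 -sum1dep_card [X in (_ + X)%N]big_mkcond -!big_split /=.
  rewrite -[RHS](card_ord m) -sum1_card; apply: eq_bigr => i _.
  rewrite !eq_F2uF2 !fcoef0 !fcoef_u.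
  by case: (fcoef 0 _) (fcoef 1 _) => -[|[|//]] ? [[|[|//]] ?].
by rewrite /N1 -{1}total; lia.
Qed.

(** The constant coefficient of c . c is N_1 modulo 2, because the square of a
   unit is 1 and u ^ 2 = 0. *)
Lemma self_dual_even_N1 m (C : {set 'rV[F2uF2]_m}) c :
  self_dual C -> c \in C -> (2 %| N1 c)%N.
Proof.
move=> Cdual cC; have : c \in dual_code C by rewrite Cdual.
rewrite inE => /forall_inP/(_ _ cC)/eqP/(congr1 (fcoef 0)).
rewrite fcoef0 (big_morph (fcoef 0) (fcoefD 0) fcoef0.1) => cc0.
have : (N1 c)%:R = 0 :> 'F_2.
  rewrite N1E natr_sum -[RHS]cc0; apply: eq_bigr => i _.
  rewrite fcoefM natr_Zp.
  by case: (fcoef 0 _) => -[|[|//]] ?; exact: val_inj.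
by move=> /(congr1 val) /=; rewrite val_Fp_nat // => /eqP.
Qed.

Section KleinGlue.
Context {R : realType} {V : vectType R} (b : {dot V for idfun}) (L : set V).
Context {n : nat} (e : n.-tuple V) (Le : is_Zbasis L e).
Context (Leven : even_lattice b L).
Context (h : nat) (s v : V).
Hypothesis s_dual : dual_lattice b L s.
Hypothesis v_dual : dual_lattice b L v.
Hypothesis s_order : L (s *+ 2).
Hypothesis v_order : L (v *+ 2).
Hypothesis sv_generate : forall x, dual_lattice b L x ->
  exists k l : int, L (x - s *~ k - v *~ l).
Hypothesis s_norm : b s s = h%:R / 2.
Hypothesis v_norm : b v v = 1.
Hypothesis sv_dot : b s v = 1 / 2.

Definition klein_glue (x : F2uF2) : V := s *+ fcoef 0 x + v *+ fcoef 1 x.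

(** As b (s, s) = h / 2, b (s, v) = 1 / 2 and b (v, v) = 1, the form of the glue
   vectors of x = x0 + x1 u and y = y0 + y1 u is, modulo the integers,
   (h x0 y0 + x0 y1 + x1 y0) / 2, where x0 y0 and x0 y1 + x1 y0 are the two
   coefficients of x y. *)
Definition klein_char (x : F2uF2) : R := (h * fcoef 0 x + fcoef 1 x)%N%:R / 2.

Let sL : subgroup L := Zbasis_subgroup Le.

Lemma dot_klein x y :
  b (klein_glue x) (klein_glue y) =
  (fcoef 0 x * fcoef 0 y * h)%N%:R / 2
  + (fcoef 0 x * fcoef 1 y + fcoef 1 x * fcoef 0 y)%N%:R / 2
  + (fcoef 1 x * fcoef 1 y)%N%:R.
Proof.
rewrite /klein_glue -!scaler_nat !(dotDl, dotDr) !(dotZl, dotZr) (dotC b v s).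
by rewrite s_norm v_norm sv_dot !(natrM, natrD); field.
Qed.

Lemma klein_reduction (u : V) (k : int) : L (u *+ 2) ->
  exists a : 'F_2, L (u *~ k - u *+ a).
Proof.
move=> Lu; have r_ge0 : (0 <= k %% 2)%Z by exact: modz_ge0.
have r_lt2 : (`|(k %% 2)%Z| < 2)%N by rewrite -ltz_nat gez0_abs // ltz_pmod.
exists (Ordinal r_lt2); rewrite /= pmulrn gez0_abs //.
have -> : u *~ k = (u *+ 2) *~ (k %/ 2)%Z + u *~ (k %% 2)%Z.
  by rewrite (pmulrn u 2) -mulrzA mulrC -mulrzDr -divz_eq.
by rewrite addrK; exact: subgroupMz.
Qed.

Lemma klein_glue_system : glue_system b L klein_glue klein_char.
Proof.
have dsub : subgroup (dual_lattice b L) := dual_subgroup b Le.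
have LD (u : V) (a c : 'F_2) : L (u *+ 2) -> L (u *+ (a + c)%R - u *+ a - u *+ c).
  move=> Lu; rewrite -addrA -opprD -mulrnDr; have [k ->] := F2_natD a c.
  rewrite mulrnDr opprD addrA subrr sub0r mulrnA.
  by apply: subgroupN => //; rewrite pmulrn; apply: subgroupMz.
have even_int (k : nat) : (2 * k)%N%:R / 2 \is a @Num.int R.
  by rewrite natr_div_int // dvdn_mulr.
split=> [x|x y|x dx|x y|x y|x x_char].
- by rewrite /klein_glue !pmulrn; apply: subgroupD => //; apply: subgroupMz.
- have := subgroupD sL (LD s (fcoef 0 x) (fcoef 0 y) s_order)
                       (LD v (fcoef 1 x) (fcoef 1 y) v_order).
  have regroup (a a1 a2 c c1 c2 : V) :
      a + c - (a1 + c1) - (a2 + c2) = (a - a1 - a2) + (c - c1 - c2).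
    by rewrite !opprD (addrACA a) (addrACA (a - a1)).
  by rewrite /klein_glue !fcoefD regroup.
- have [k [l xkl]] := sv_generate dx.
  have [a sa] := klein_reduction k s_order; have [c vc] := klein_reduction l v_order.
  have [y [ya yc]] := F2uF2_coordinates a c; exists y; rewrite /klein_glue ya yc.
  have -> : x - (s *+ a + v *+ c) =
      (x - s *~ k - v *~ l) + (s *~ k - s *+ a) + (v *~ l - v *+ c).
    by rewrite (addrAC x) subrKA (addrAC x) subrKA opprD addrA.
  by apply: subgroupD => //; apply: subgroupD.
- have [k0 E0] := F2_natD (fcoef 0 x) (fcoef 0 y).
  have [k1 E1] := F2_natD (fcoef 1 x) (fcoef 1 y).
  have -> : klein_char (x + y) - klein_char x - klein_char y =
      - ((2 * (h * k0 + k1))%N%:R / 2).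
    rewrite /klein_char !fcoefD.
    have -> : (2 * (h * k0 + k1) = h * (fcoef 0 x + fcoef 0 y) +
      (fcoef 1 x + fcoef 1 y) - (h * (fcoef 0 x + fcoef 0 y)%R +
      (fcoef 1 x + fcoef 1 y)%R))%N by rewrite E0 E1; lia.
    rewrite natrB; last by rewrite leq_add ?leq_mul // ?E0 ?E1 leq_addr.
    by rewrite !(natrD, natrM); field.
  by rewrite rpredN.
- have [k E] := F2_natD (fcoef 0 x * fcoef 1 y) (fcoef 1 x * fcoef 0 y).
  rewrite dot_klein /klein_char !fcoefM F2_natM -!F2_natM E !F2_natM natrD.
  set w := (_ * _ * h)%N.
  set u : 'F_2 := (fcoef 0 x * fcoef 1 y + _)%R; rewrite (mulnC h) natrD -/w.
  have -> : w%:R / 2 + (u%:R + (2 * k)%N%:R) / 2 + (fcoef 1 x * fcoef 1 y)%N%:R -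
     (w%:R + u%:R) / 2 = (2 * k)%N%:R / 2 + (fcoef 1 x * fcoef 1 y)%N%:R :> R by field.
  by rewrite rpredD ?natr_int.
- have F2_even (a : 'F_2) : (2 %| a)%N -> a = 0.
    by case: a => -[|[|//]] ? // _; exact: val_inj.
  have x0 : fcoef 0 x = 0.
    apply: F2_even; rewrite -(natr_div_int R) //.
    have := x_char F2u; rewrite /klein_char !fcoefM !fcoef_u.
    by rewrite !mulr0 mulr1 addr0 muln0 add0n.
  apply: F2uF2P; rewrite fcoef0 //; apply: F2_even; rewrite -(natr_div_int R) //.
  by have := x_char 1; rewrite mulr1 /klein_char x0 muln0 add0n.
Qed.

(** The glue vectors of 1, u and 1 + u have norms h / 2, 1 and h / 2 + 2. *)
Lemma klein_norm m (c : 'rV[F2uF2]_m) :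
  (\sum_i b (klein_glue (c 0 i)) (klein_glue (c 0 i))) / 2 \is a Num.int =
  (4 %| h * N1 c + 2 * N2 c)%N.
Proof.
pose K := (\sum_i fcoef 0 (c 0%R i) * fcoef 1 (c 0%R i))%N.
have -> : \sum_i b (klein_glue (c 0 i)) (klein_glue (c 0 i)) =
    (h * N1 c + 2 * N2 c + 4 * K)%N%:R / 2.
  rewrite N1E N2E !big_distrr -!big_split natr_sum mulr_suml /=.
  apply: eq_bigr => i _; rewrite dot_klein eq_F2uF2 !fcoef_u.
  case: (fcoef 0 _) (fcoef 1 _) => -[|[|//]] ? [[|[|//]] ?] /=;
    by rewrite !(natrD, natrM); field.
rewrite -mulrA -invfM -natrM natr_div_int // dvdn_addl //; exact: dvdn_mulr.
Qed.

(** Since N_1 is even, h N_1 is N_1 modulo 4 up to sign for h odd and vanishes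
   modulo 4 for h even. The condition 4 | h N_1 + 2 N_2 is then that the Lee
   weight is divisible by 4, respectively that N_2, or equivalently the Hamming
   weight, is even. *)
Lemma klein_glue_codes m (C : {set 'rV[F2uF2]_m}) : is_code C ->
  [/\ odd h -> even_unimodular_iff b L C (typeII_F2u C)
    & ~~ odd h -> even_unimodular_iff b L C (typeIV_F2u C)].
Proof.
move=> codeC; have [rho rhoP] := glue_even_unimodular Le Leven klein_glue_system.
have [Glat GE] := rhoP m C codeC; split=> h_parity; exists rho; split=> //;
  rewrite GE; split=> -[Cdual Cw]; split=> // c cC; have := Cw c cC;
  have := self_dual_even_N1 Cdual cC; rewrite klein_norm /lee_weight /hamming_weight;
  move=> /dvdnP[a ->]; rewrite -[h]odd_double_half ?h_parity ?(negPf h_parity); lia.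
Qed.

End KleinGlue.

(** * Root lattices: coefficients and fundamental weights *)

(** The chain 1, ..., n - 1 with the vertex n attached to the vertex p: the
   diagrams A_n, D_n and E_n are the cases p = n - 1, n - 2 and n - 3. *)
Definition adjT (n p i j : nat) : bool :=
  (consecutive i j && ~~ is_pair i j (n - 1) n) || is_pair i j p n.

Lemma adjA_T n i j : (0 < i <= n)%N -> (0 < j <= n)%N ->
  adjA i j = adjT n (n - 1) i j.
Proof. rewrite /adjA /adjT /consecutive /is_pair; lia. Qed.

(** The pairing of the combination with coefficients a 1, ..., a n with the
   k-th basis vector, under the convention a 0 = 0, which spares a special case
   at the beginning of the chain. *)
Definition cartan {R : realType} (n p : nat) (a : nat -> R) (k : nat) : R :=
  if k == n then 2 * a n - a p
  else 2 * a k - a k.-1 - (if (k.+1 < n)%N then a k.+1 else 0)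
       - (if k == p then a n else 0).

Section Diagram.
Context {R : realType} {V : vectType R} (b : {dot V for idfun}) (L : set V).
Context {n : nat} (e : n.-tuple V) (Le : is_Zbasis L e) (p : nat).
Hypothesis p_lt_n : (p < n)%N.
Hypothesis gram : forall i j : 'I_n, b (tnth e i) (tnth e j) =
  if i == j then 2 else if adjT n p i.+1 j.+1 then -1 else 0.
Implicit Types (a : nat -> R) (x : V).

Definition comb a : V := \sum_(j < n) a j.+1 *: tnth e j.

Lemma comb_span a : comb a \in <<e>>%VS.
Proof. by apply: rpred_sum => j _; apply/rpredZ/memv_span/mem_tnth. Qed.

Lemma comb_onto x : x \in <<e>>%VS -> exists2 a, a 0%N = 0 & x = comb a.
Proof.
move=> x_e; exists (fun k => if k is k'.+1 then
    if insub k' is Some j then coord e j x else 0 else 0) => //.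
rewrite {1}(coord_span x_e); apply: eq_bigr => j _.
by rewrite valK -tnth_nth.
Qed.

Lemma comb_lattice a :
  (forall k, (0 < k <= n)%N -> a k \is a Num.int) -> L (comb a).
Proof.
move=> a_int; apply: subgroup_sum => [|j _]; first exact: (Zbasis_subgroup Le).
have /intrP[k ->] := a_int j.+1 (ltn_ord j).
rewrite scaler_int; apply: subgroupMz; first exact: (Zbasis_subgroup Le).
exact: (Zbasis_mem Le).
Qed.

Lemma combB a a' : comb a - comb a' = comb (fun k => a k - a' k).
Proof. by rewrite /comb -sumrB; apply: eq_bigr => j _; rewrite scalerBl. Qed.

Lemma combZ a c : c *: comb a = comb (fun k => c * a k).
Proof. by rewrite /comb scaler_sumr; apply: eq_bigr => j _; rewrite scalerA. Qed.

Lemma dot_comb x a : b x (comb a) = \sum_(j < n) a j.+1 * b x (tnth e j).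
Proof. by rewrite dot_sumr; apply: eq_bigr => j _; rewrite dotZr. Qed.

Lemma dot_comb_delta x a k : (0 < k <= n)%N ->
  (forall i : 'I_n, b x (tnth e i) = (i.+1 == k)%:R) -> b x (comb a) = a k.
Proof.
case: k => // k k_lt xe; rewrite dot_comb (bigD1 (Ordinal k_lt)) //=.
rewrite xe eqxx mulr1 big1 ?addr0 // => j jk.
by rewrite xe eqSS -val_eqE /= in jk *; rewrite (negPf jk) mulr0.
Qed.

Lemma sum_pick k (c : R) :
  \sum_(j < n) (if j.+1 == k then c else 0) = if (0 < k <= n)%N then c else 0.
Proof.
case: k => [|k]; first by rewrite big1.
case: (ltnP k n) => [k_lt|k_ge].
  rewrite (bigD1 (Ordinal k_lt)) //= eqxx big1 ?addr0 // => j.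
  by rewrite -val_eqE /= eqSS => /negPf->.
rewrite big1 // => j _; rewrite eqSS; case: eqP => // jk.
by have := ltn_ord j; rewrite jk ltnNge k_ge.
Qed.

Lemma cartan_row a (i : 'I_n) : a 0%N = 0 ->
  b (comb a) (tnth e i) = cartan n p a i.+1.
Proof.
move=> a0; have i_n := ltn_ord i; rewrite /cartan /=.
have term (j : 'I_n) : b (a j.+1 *: tnth e j) (tnth e i) =
    a j.+1 * (if j.+1 == i.+1 then 2 else if adjT n p j.+1 i.+1 then -1 else 0).
  by rewrite dotZl gram -val_eqE eqSS.
rewrite dot_suml (eq_bigr _ (fun j _ => term j)) => {term}; case: ifP => kn.
  transitivity (\sum_(j < n) ((if j.+1 == n then 2 * a n else 0)
      - (if j.+1 == p then a p else 0))).
    apply: eq_bigr => j _; have j_n := ltn_ord j.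
    move: (nat_of_ord i) (nat_of_ord j) i_n j_n kn => {}i {}j i_n j_n /eqP kn.
    rewrite kn; have [-> | jn] := eqVneq j.+1 n.
      by rewrite gtn_eqF // subr0 mulrC.
    rewrite sub0r; have [jp | jp] := eqVneq j.+1 p.
      by rewrite ifT ?mulrN1 ?jp //; move: jp jn; rewrite /adjT /is_pair; lia.
    rewrite ifF ?mulr0 ?oppr0 //.
    by move: jn jp; rewrite /adjT /consecutive /is_pair; lia.
  rewrite sumrB !sum_pick leqnn (leq_ltn_trans _ p_lt_n) //.
  by case: (p) p_lt_n => [|q] //= q_n; rewrite ?a0 // ltnW.
transitivity (\sum_(j < n) ((if j.+1 == i.+1 then 2 * a i.+1 else 0)
    - (if j.+1 == i then a i else 0)
    - (if j.+1 == i.+2 then if (i.+2 < n)%N then a i.+2 else 0 else 0)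
    - (if j.+1 == n then if i.+1 == p then a n else 0 else 0))).
  apply: eq_bigr => j _; have j_n := ltn_ord j.
  move: (nat_of_ord i) (nat_of_ord j) i_n j_n kn => {}i {}j i_n j_n kn.
  have [-> | ji] := eqVneq j.+1 i.+1.
    by rewrite kn gtn_eqF // ltn_eqF // !subr0 mulrC.
  have [ji' | ji'] := eqVneq j.+1 i.
    rewrite ifT; last first.
      by move: ji' kn i_n; rewrite /adjT /consecutive /is_pair; lia.
    rewrite ifF; last by lia.
    by rewrite ifF ?mulrN1 ?ji' ?subr0 ?sub0r //; lia.
  have [jn | jn] := eqVneq j.+1 n.
    have -> : adjT n p j.+1 i.+1 = (i.+1 == p).
      by move: kn ji' ji p_lt_n; rewrite jn /adjT /consecutive /is_pair; lia.
    have -> : (if j.+1 == i.+2 then if (i.+2 < n)%N then a i.+2 else 0 else 0) = 0.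
      by rewrite jn; case: eqP => // ->; rewrite ltnn.
    by rewrite jn !subr0 sub0r; case: ifP => _; rewrite ?mulrN1 ?mulr0 ?oppr0.
  have -> : adjT n p j.+1 i.+1 = (j.+1 == i.+2).
    by move: kn ji' ji jn p_lt_n j_n; rewrite /adjT /consecutive /is_pair; lia.
  rewrite !subr0 sub0r; case: eqP => [ji2 | _]; last by rewrite mulr0 oppr0.
  by rewrite -ji2 ltn_neqAle jn j_n mulrN1.
rewrite !sumrB !sum_pick i_n leqnn (leq_ltn_trans (leq0n _) i_n) /= (ltnW i_n) andbT.
congr (_ - _ - _ - _); first by case: (nat_of_ord i).
by case: ifP => // i2; case: ifP => // /ltnW; rewrite i2.
Qed.

Lemma diagram_even : even_lattice b L.
Proof.
apply: even_lattice_Zbasis Le _ _ => [i j|i]; rewrite gram ?eqxx //.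
by case: ifP => _; [|case: ifP => _]; rewrite ?rpredN ?rpred0 ?rpred1 ?natr_int.
Qed.

Lemma dual_combP a : a 0%N = 0 -> dual_lattice b L (comb a) <->
  forall k, (0 < k <= n)%N -> cartan n p a k \is a Num.int.
Proof.
move=> a0; rewrite (dual_lattice_Zbasis b Le); split=> [[_ a_int] [//|k] k_n | a_int].
  by have := a_int (Ordinal k_n); rewrite cartan_row.
by split=> [|i]; [exact: comb_span | rewrite cartan_row // a_int /=].
Qed.

Lemma dual_comb_onto x : dual_lattice b L x -> exists a,
  [/\ a 0%N = 0, x = comb a &
      forall k, (0 < k <= n)%N -> cartan n p a k \is a Num.int].
Proof.
move=> dx; have [/comb_onto[a a0 xE] _] := (dual_lattice_Zbasis b Le x).1 dx.
by exists a; split=> //; apply/dual_combP => //; rewrite -xE.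
Qed.

Section FundamentalWeight.
Context (w : nat -> R) (k0 : nat).
Hypothesis k0_n : (0 < k0 <= n)%N.
Hypothesis w0 : w 0%N = 0.
Hypothesis cartan_w : forall k, (0 < k <= n)%N -> cartan n p w k = (k == k0)%:R.

Lemma fundamental_dual : dual_lattice b L (comb w).
Proof. by apply/dual_combP => // k k_n; rewrite cartan_w // natr_int. Qed.

(** The case a = w gives the norm of a fundamental weight without inverting the
   Gram matrix. *)
Lemma dot_fundamental a : b (comb w) (comb a) = a k0.
Proof.
by apply: dot_comb_delta => // i; rewrite cartan_row // cartan_w //=.
Qed.

Lemma fundamental_order (N : nat) :
  (forall k, (0 < k <= n)%N -> N%:R * w k \is a Num.int) -> L (comb w *+ N).
Proof. by move=> Nw; rewrite -scaler_nat combZ; exact: comb_lattice. Qed.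

Section Cyclic.
Context (N q : nat).
Hypothesis N_gt1 : (1 < N)%N.
Hypothesis w_order : forall k, (0 < k <= n)%N -> N%:R * w k \is a Num.int.
Hypothesis w_generates : forall a, a 0%N = 0 ->
  (forall k, (0 < k <= n)%N -> cartan n p a k \is a Num.int) ->
  exists z : int, forall k, (0 < k <= n)%N -> a k - z%:~R * w k \is a Num.int.
Hypothesis w_norm : w k0 = q%:R / N%:R.
Hypothesis q_coprime : coprime q N.

Let w_cover x : dual_lattice b L x -> exists z : int, L (x - comb w *~ z).
Proof.
move=> /dual_comb_onto[a [a0 -> /w_generates[]// z az]].
by exists z; rewrite -scaler_int combZ combB; exact: comb_lattice.
Qed.

Let w_dot : b (comb w) (comb w) = q%:R / N%:R.
Proof. by rewrite dot_fundamental. Qed.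

Lemma cyclic_diagram_even m (C : {set 'rV['Z_N]_m}) : ~~ odd N -> is_code C ->
  even_unimodular_iff b L C (typeII_Z N C).
Proof.
exact (@cyclic_glue_even _ _ _ _ _ _ Le diagram_even _ _ _ N_gt1 fundamental_dual
  (fundamental_order w_order) w_cover w_dot q_coprime m C).
Qed.

Lemma cyclic_diagram_odd m (C : {set 'rV['Z_N]_m}) : odd N -> ~~ odd q ->
  is_code C -> even_unimodular_iff b L C (self_dual C).
Proof.
exact (@cyclic_glue_odd _ _ _ _ _ _ Le diagram_even _ _ _ N_gt1 fundamental_dual
  (fundamental_order w_order) w_cover w_dot q_coprime m C).
Qed.

End Cyclic.
End FundamentalWeight.
End Diagram.

(** * Coefficients of dual vectors modulo 1 *)

Section Arithmetic.
Context {R : realType}.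
Implicit Types (a : nat -> R) (k : nat).

(** Along a chain starting at an end vertex the coefficients satisfy
   a (k + 1) = 2 a k - a (k - 1) modulo 1, the recursion of the multiples of
   a 1. *)
Lemma chain_multiples a q : a 0%N = 0 ->
  (forall k, (0 < k < q)%N -> 2 * a k - a k.-1 - a k.+1 \is a Num.int) ->
  forall k, (k <= q)%N -> a k - k%:R * a 1%N \is a Num.int.
Proof.
move=> a0 row k; elim/ltn_ind: k => -[|[|k]] IHk k_q.
- by rewrite a0 mul0r subrr rpred0.
- by rewrite mul1r subrr rpred0.
have -> : a k.+2 - k.+2%:R * a 1%N =
    2 * (a k.+1 - k.+1%:R * a 1%N) - (a k - k%:R * a 1%N)
    - (2 * a k.+1 - a k - a k.+2) by rewrite -!natr1; ring.
have row_k := row k.+1 k_q; rewrite /= in row_k.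
have k1_q : (k.+1 <= q)%N by exact: ltnW.
rewrite rpredB // rpredB //; last by apply: IHk; rewrite // ltnW.
by rewrite rpredM ?natr_int //; exact: IHk.
Qed.

Section TypeA.
Context (n : nat).
Hypothesis n_gt0 : (0 < n)%N.

Lemma cartanA a k : (0 < k < n)%N ->
  cartan n (n - 1) a k = 2 * a k - a k.-1 - a k.+1.
Proof.
move=> k_n; rewrite /cartan; have -> : (k == n) = false by lia.
have [kn|kn] := ltnP k.+1 n.
  have -> : (k == n - 1)%N = false by lia. by rewrite subr0.
have -> : (k == n - 1)%N by lia. by rewrite subr0; congr (_ - a _); lia.
Qed.

Definition weightA k : R := k%:R / n.+1%:R.

Lemma cartan_weightA k : (0 < k <= n)%N ->
  cartan n (n - 1) weightA k = (k == n)%:R.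
Proof.
have n1 : n.+1%:R != 0 :> R by rewrite pnatr_eq0.
move=> /andP[k_gt0]; rewrite leq_eqVlt => /orP[/eqP-> | k_n].
  by rewrite /cartan eqxx /weightA natrB // -[n.+1]addn1 natrD /=; field; rewrite natr1.
rewrite cartanA ?k_gt0 // ltn_eqF // /weightA.
case: k k_gt0 {k_n} => // k _; rewrite /= -[k.+2]addn2 -[k.+1]addn1.
by rewrite !natrD; field; rewrite addrC natr1.
Qed.

(** All the coefficients are multiples of a 1 modulo 1, and the relation at the
   last vertex says that (n + 1) a 1 is an integer. *)
Lemma weightA_generates a : a 0%N = 0 ->
  (forall k, (0 < k <= n)%N -> cartan n (n - 1) a k \is a Num.int) ->
  exists z : int, forall k, (0 < k <= n)%N -> a k - z%:~R * weightA k \is a Num.int.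
Proof.
move=> a0 row; have chain : forall k, (k <= n)%N -> a k - k%:R * a 1%N \is a Num.int.
  apply: chain_multiples a0 _ => k /andP[k_gt0 k_n].
  by rewrite -cartanA ?k_gt0 //; apply: row; rewrite k_gt0 ltnW.
have n1 : n.+1%:R != 0 :> R by rewrite pnatr_eq0.
have /intrP[z zE] : n.+1%:R * a 1%N \is a Num.int.
  have -> : n.+1%:R * a 1%N = (2 * a n - a (n - 1)%N)
      - 2 * (a n - n%:R * a 1%N) + (a (n - 1)%N - (n - 1)%:R * a 1%N).
    by rewrite natrB // -[n.+1]addn1 natrD; ring.
  apply: rpredD; last by apply: chain; rewrite leq_subr.
  apply: rpredB; first by have := row n; rewrite /cartan eqxx; apply; rewrite n_gt0 /=.
  by apply: rpredM; [rewrite natr_int | exact: chain].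
exists z => k /andP[_ k_n]; rewrite -zE /weightA.
have -> : n.+1%:R * a 1%N * (k%:R / n.+1%:R) = k%:R * a 1%N.
  by field; rewrite addrC natr1.
exact: chain.
Qed.

Lemma weightA_order k : n.+1%:R * weightA k \is a Num.int.
Proof. by rewrite /weightA mulrC divfK ?natr_int // pnatr_eq0. Qed.

End TypeA.

Section TypeD.
Context (p : nat).
Hypothesis p_gt1 : (1 < p)%N.
Let n := p.+2.

Lemma cartanD a :
  [/\ forall k, (0 < k < p)%N -> cartan n p a k = 2 * a k - a k.-1 - a k.+1,
      cartan n p a p = 2 * a p - a p.-1 - a p.+1 - a p.+2,
      cartan n p a p.+1 = 2 * a p.+1 - a p
    & cartan n p a p.+2 = 2 * a p.+2 - a p].
Proof.
rewrite /cartan /n; split=> [k k_p|||].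
- have -> : (k == p.+2) = false by lia.
  have -> : (k == p) = false by lia. by rewrite ifT ?subr0 //; lia.
- have -> : (p == p.+2) = false by lia. by rewrite eqxx ltnS leqnn.
- by rewrite eqSS (ltn_eqF (ltnSn p)) (gtn_eqF (ltnSn p)) ltnn !subr0.
- by rewrite eqxx.
Qed.

(** The fundamental weight of the last vertex, of norm n / 4 where n = p + 2. *)
Definition spinor k : R :=
  if (k <= p)%N then k%:R / 2 else if k == p.+1 then p%:R / 4 else p.+2%:R / 4.

(** The fundamental weight of the first vertex, of norm 1. *)
Definition vectorD k : R :=
  if k == 0%N then 0 else if (k <= p)%N then 1 else 1 / 2.

Lemma spinorE : [/\ forall k, (k <= p)%N -> spinor k = k%:R / 2,
  spinor p.+1 = p%:R / 4 & spinor p.+2 = p.+2%:R / 4].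
Proof.
rewrite /spinor ltnn eqxx; split=> // [k -> //|].
by rewrite ifF; [rewrite ifF //; lia | lia].
Qed.

Lemma vectorDE : [/\ vectorD 0 = 0, forall k, (0 < k <= p)%N -> vectorD k = 1,
  vectorD p.+1 = 1 / 2 & vectorD p.+2 = 1 / 2].
Proof.
rewrite /vectorD ltnn; split=> // [[|k] // /andP[_ ->] //|].
by rewrite ifF //; lia.
Qed.

Lemma vertexD_ind (P : nat -> Prop) :
  (forall k, (0 < k <= p)%N -> P k) -> P p.+1 -> P p.+2 ->
  forall k, (0 < k <= n)%N -> P k.
Proof.
move=> Pk P1 P2 k k_n; have [k_p|k_p] := leqP k p; first by apply: Pk; lia.
by have [-> | ->] : k = p.+1 \/ k = p.+2; first lia.
Qed.

Lemma cartan_spinor k : (0 < k <= n)%N -> cartan n p spinor k = (k == n)%:R.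
Proof.
have [cE cp c1 c2] := cartanD spinor; have [sE s1 s2] := spinorE.
move: k; apply: vertexD_ind => [k /andP[k_gt0]||].
- move=> k_le; rewrite ltn_eqF; last exact: leqW.
  move: k_le; rewrite leq_eqVlt => /orP[/eqP->|k_p]; last first.
    rewrite cE ?k_gt0 // !sE ?(ltnW k_p) ?(leq_trans (leq_pred _) (ltnW k_p)) //.
    by case: k k_gt0 {k_p} => // k _; rewrite /= -!natr1; field.
  rewrite cp (sE p) // (sE p.-1) ?leq_pred // s1 s2.
  by case: (p) p_gt1 => // r _; rewrite /= -!natr1; field.
- by rewrite c1 s1 sE // ltn_eqF //=; field.
- by rewrite c2 s2 sE // eqxx -!natr1 /=; field.
Qed.

Lemma cartan_vectorD k : (0 < k <= n)%N -> cartan n p vectorD k = (k == 1%N)%:R.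
Proof.
have [cE cp c1 c2] := cartanD vectorD; have [v0 vE v1 v2] := vectorDE.
have vp : vectorD p = 1 by apply: vE; lia.
move: k; apply: vertexD_ind => [k /andP[k_gt0]||].
- rewrite leq_eqVlt => /orP[/eqP->|k_p].
    have vp' : vectorD p.-1 = 1 by apply: vE; lia.
    by rewrite cp vp vp' v1 v2 gtn_eqF //=; field.
  rewrite cE ?k_gt0 // (vE k) ?k_gt0 1?ltnW // (vE k.+1) //.
  have [-> | k1] := eqVneq k 1%N; first by rewrite v0 /=; ring.
  by rewrite (vE k.-1) /=; [ring | lia].
- by rewrite c1 v1 vp gtn_eqF /=; [field | lia].
- by rewrite c2 v2 vp gtn_eqF /=; [field | lia].
Qed.

(** Modulo 1 the coefficients of a dual vector are determined by a 1 and
   a (p + 2). Comparing the sum of the relations at the two short ends with the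
   relation at the branch vertex gives 2 a 1 = 0. *)
Lemma coefD_mod1 a : a 0%N = 0 ->
  (forall k, (0 < k <= n)%N -> cartan n p a k \is a Num.int) ->
  [/\ forall k, (k <= p)%N -> a k - k%:R * a 1%N \is a Num.int,
      2 * a 1%N \is a Num.int,
      2 * a p.+2 - p%:R * a 1%N \is a Num.int
    & a p.+1 + a p.+2 - p.+1%:R * a 1%N \is a Num.int].
Proof.
move=> a0 row; have [cE cp c1 c2] := cartanD a.
have chain : forall k, (k <= p)%N -> a k - k%:R * a 1%N \is a Num.int.
  apply: chain_multiples a0 _ => k /andP[k_gt0 k_p].
  by rewrite -cE ?k_gt0 //; apply: row; rewrite k_gt0 /n; lia.
have two : (2 : R) \is a Num.int by rewrite natr_int.
have rowp : 2 * a p - a p.-1 - a p.+1 - a p.+2 \is a Num.int.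
  by rewrite -cp row // /n; lia.
have row1 : 2 * a p.+1 - a p \is a Num.int by rewrite -c1 row // /n; lia.
have row2 : 2 * a p.+2 - a p \is a Num.int by rewrite -c2 row // /n; lia.
have fork : a p.+1 + a p.+2 - p.+1%:R * a 1%N \is a Num.int.
  have -> : a p.+1 + a p.+2 - p.+1%:R * a 1%N = 2 * (a p - p%:R * a 1%N)
      - (a p.-1 - p.-1%:R * a 1%N) - (2 * a p - a p.-1 - a p.+1 - a p.+2).
    have -> : p%:R = p.-1%:R + 1 :> R by rewrite natr1 prednK // ltnW.
    have -> : p.+1%:R = p.-1%:R + 2 :> R by rewrite -natrD addn2 prednK // ltnW.
    by ring.
  apply: rpredB rowp; apply: rpredB; last by apply: chain; rewrite leq_pred.
  by apply: rpredM => //; exact: chain.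
split=> //.
  have -> : 2 * a 1%N = (2 * a p.+1 - a p) + (2 * a p.+2 - a p)
      + 2 * (a p - p%:R * a 1%N) - 2 * (a p.+1 + a p.+2 - p.+1%:R * a 1%N).
    by rewrite -natr1; ring.
  apply: rpredB; last exact: rpredM.
  by apply: rpredD; [exact: rpredD | apply: rpredM => //; exact: chain].
have -> : 2 * a p.+2 - p%:R * a 1%N = (2 * a p.+2 - a p) + (a p - p%:R * a 1%N) by ring.
by apply: rpredD => //; exact: chain.
Qed.

(** With T = a (p + 2), a multiple z of the spinor weight must satisfy
   z n / 4 = T modulo 1. As n is odd, n ^ 2 = 1 modulo 4, and as 4 T is an
   integer, z = 4 n T is a solution. *)
Lemma spinor_generates a : odd p -> a 0%N = 0 ->
  (forall k, (0 < k <= n)%N -> cartan n p a k \is a Num.int) ->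
  exists z : int, forall k, (0 < k <= n)%N -> a k - z%:~R * spinor k \is a Num.int.
Proof.
move=> p_odd a0 row; have [chain A2 T2 fork] := coefD_mod1 a0 row.
have [sE s1 s2] := spinorE.
set A := a 1%N in chain A2 T2 fork *; set T := a p.+2 in T2 fork *.
have [r pE] : exists r, p = (2 * r + 1)%N by exists p./2; lia.
have T4 : 4 * T \is a Num.int.
  have -> : 4 * T = 2 * (2 * T - p%:R * A) + p%:R * (2 * A) by ring.
  by apply: rpredD; apply: rpredM; rewrite ?natr_int.
have /intrP[z zE] : n%:R * (4 * T) \is a Num.int by rewrite rpredM ?natr_int.
exists z; rewrite -zE; apply: vertexD_ind => [k /andP[_ k_p]||].
- rewrite sE //.
  have -> : a k - n%:R * (4 * T) * (k%:R / 2) = (a k - k%:R * A)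
      - (n * k)%:R * (2 * T - p%:R * A)
      - (k * (2 * r ^ 2 + 4 * r + 1))%N%:R * (2 * A).
    by rewrite /n pE !(natrM, natrD, natrX) -!natr1 !(natrM, natrD, natrX); field.
  apply: rpredB; last by apply: rpredM; rewrite ?natr_int.
  by apply: rpredB; [exact: chain | apply: rpredM; rewrite ?natr_int].
- rewrite s1.
  have -> : a p.+1 - n%:R * (4 * T) * (p%:R / 4) = (a p.+1 + T - p.+1%:R * A)
     - ((r + 1) ^ 2)%N%:R * (4 * T) + (r + 1)%:R * (2 * A).
    by rewrite /n pE !(natrM, natrD, natrX) -!natr1 !(natrM, natrD, natrX); field.
  apply: rpredD; last by apply: rpredM; rewrite ?natr_int.
  by apply: rpredB => //; apply: rpredM; rewrite ?natr_int.
- rewrite s2 -/T.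
  have -> : T - n%:R * (4 * T) * (p.+2%:R / 4) = - (((r + 1) * (r + 2))%N%:R * (4 * T)).
    by rewrite /n pE !(natrM, natrD, natrX) -!natr1 !(natrM, natrD, natrX); field.
  by rewrite rpredN rpredM ?natr_int.
Qed.

(** The multiple y of the spinor weight is determined modulo 2 by a 1 = y / 2
   modulo 1, and then the multiple z of the vector weight by the last
   coefficient. *)
Lemma spinor_vector_generate a : ~~ odd p -> a 0%N = 0 ->
  (forall k, (0 < k <= n)%N -> cartan n p a k \is a Num.int) ->
  exists y z : int, forall k, (0 < k <= n)%N ->
    a k - y%:~R * spinor k - z%:~R * vectorD k \is a Num.int.
Proof.
move=> p_even a0 row; have [chain A2 T2 fork] := coefD_mod1 a0 row.
have [sE s1 s2] := spinorE; have [v0 vE v1 v2] := vectorDE.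
set A := a 1%N in chain A2 T2 fork *; set T := a p.+2 in T2 fork *.
have /intrP[y yE] := A2; have zint : 2 * T - p.+2%:R * A \is a Num.int.
  have -> : 2 * T - p.+2%:R * A = (2 * T - p%:R * A) - 2 * A by rewrite -!natr1; ring.
  exact: rpredB.
have /intrP[z zE] := zint.
exists y, z; rewrite -yE -zE; apply: vertexD_ind => [k k_p||].
- rewrite sE 1?vE //; last by case/andP: k_p.
  have -> : a k - 2 * A * (k%:R / 2) - (2 * T - p.+2%:R * A) * 1 =
      (a k - k%:R * A) - (2 * T - p.+2%:R * A) by field.
  by apply: rpredB => //; apply: chain; case/andP: k_p.
- rewrite s1 v1.
  have -> : a p.+1 - 2 * A * (p%:R / 4) - (2 * T - p.+2%:R * A) * (1 / 2) =
      (a p.+1 + T - p.+1%:R * A) - (2 * T - p.+2%:R * A).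
    by rewrite -!natr1; field.
  exact: rpredB.
- rewrite s2 v2 -/T.
  have -> : T - 2 * A * (p.+2%:R / 4) - (2 * T - p.+2%:R * A) * (1 / 2) = 0 by field.
  exact: rpred0.
Qed.

End TypeD.
End Arithmetic.

(** * Types E_6 and E_7 *)

Section TypeE.
Context {R : realType}.
Implicit Types (a : nat -> R) (k : nat).

(** The fundamental weight of the vertex 5, at the end of a long arm; its norm
   is 4 / 3. *)
Definition weightE6 : nat -> R :=
  nth 0 [:: 0; 2 / 3; 4 / 3; 2; 5 / 3; 4 / 3; 1].

Lemma cartan_weightE6 k : (0 < k <= 6)%N -> cartan 6 3 weightE6 k = (k == 5)%:R.
Proof.
by case: k => [|[|[|[|[|[|[|k]]]]]]] // _; rewrite /cartan /weightE6 /=; field.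
Qed.

Lemma weightE6_order k : (0 < k <= 6)%N -> 3 * weightE6 k \is a Num.int.
Proof.
move=> k_n; apply/intrP; exists (nth 0%Z [:: 0; 2; 4; 6; 5; 4; 3]%Z k).
by case: k k_n => [|[|[|[|[|[|[|k]]]]]]] // _; rewrite /weightE6 /=; lra.
Qed.

Lemma weightE6_generates a : a 0%N = 0 ->
  (forall k, (0 < k <= 6)%N -> cartan 6 3 a k \is a Num.int) ->
  exists z : int, forall k, (0 < k <= 6)%N -> a k - z%:~R * weightE6 k \is a Num.int.
Proof.
move=> a0 row.
have [/intrP[c1 E1] /intrP[c2 E2]] := (row 1 isT, row 2 isT).
have [/intrP[c3 E3] /intrP[c4 E4]] := (row 3 isT, row 4 isT).
have [/intrP[c5 E5] /intrP[c6 E6]] := (row 5 isT, row 6 isT).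
rewrite /cartan /= ?a0 in E1 E2 E3 E4 E5 E6.
(* The multiple z is 3 a 5; it and the witnesses below come from the inverse of
   the Cartan matrix, whose entries have denominator 3. *)
exists (2 * c1 + 4 * c2 + 6 * c3 + 5 * c4 + 4 * c5 + 3 * c6) => k k_n.
apply/intrP; exists (nth 0 [:: 0;
  - (c2 + 2 * c3 + 2 * c4 + 2 * c5 + c6);
  - (c1 + 2 * c2 + 4 * c3 + 4 * c4 + 4 * c5 + 2 * c6);
  - (2 * c1 + 4 * c2 + 6 * c3 + 6 * c4 + 6 * c5 + 3 * c6);
  - (2 * c1 + 4 * c2 + 6 * c3 + 5 * c4 + 5 * c5 + 3 * c6);
  - (2 * c1 + 4 * c2 + 6 * c3 + 5 * c4 + 4 * c5 + 3 * c6);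
  - (c1 + 2 * c2 + 3 * c3 + 3 * c4 + 3 * c5 + c6)] k).
by case: k k_n => [|[|[|[|[|[|[|k]]]]]]] // _; rewrite /weightE6 /=;
  rewrite !(rmorphN, rmorphD, rmorphM) /= -E1 -E2 -E3 -E4 -E5 -E6; lra.
Qed.

(** The fundamental weight of the vertex 1, at the end of the longest arm; its
   norm is 3 / 2. *)
Definition weightE7 : nat -> R :=
  nth 0 [:: 0; 3 / 2; 2; 5 / 2; 3; 2; 1; 3 / 2].

Lemma cartan_weightE7 k : (0 < k <= 7)%N -> cartan 7 4 weightE7 k = (k == 1%N)%:R.
Proof.
by case: k => [|[|[|[|[|[|[|[|k]]]]]]]] // _; rewrite /cartan /weightE7 /=; field.
Qed.

Lemma weightE7_order k : (0 < k <= 7)%N -> 2 * weightE7 k \is a Num.int.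
Proof.
move=> k_n; apply/intrP; exists (nth 0%Z [:: 0; 3; 4; 5; 6; 4; 2; 3]%Z k).
by case: k k_n => [|[|[|[|[|[|[|[|k]]]]]]]] // _; rewrite /weightE7 /=; lra.
Qed.

Lemma weightE7_generates a : a 0%N = 0 ->
  (forall k, (0 < k <= 7)%N -> cartan 7 4 a k \is a Num.int) ->
  exists z : int, forall k, (0 < k <= 7)%N -> a k - z%:~R * weightE7 k \is a Num.int.
Proof.
move=> a0 row.
have [/intrP[c1 E1] /intrP[c2 E2]] := (row 1 isT, row 2 isT).
have [/intrP[c3 E3] /intrP[c4 E4]] := (row 3 isT, row 4 isT).
have [/intrP[c5 E5] /intrP[c6 E6]] := (row 5 isT, row 6 isT).
have /intrP[c7 E7] := row 7 isT.
rewrite /cartan /= ?a0 in E1 E2 E3 E4 E5 E6 E7.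
(* The multiple z is 2 a 1; it and the witnesses below come from the inverse of
   the Cartan matrix, whose entries have denominator 2. *)
exists (3 * c1 + 4 * c2 + 5 * c3 + 6 * c4 + 4 * c5 + 2 * c6 + 3 * c7) => k k_n.
apply/intrP; exists (nth 0 [:: 0;
  - (3 * c1 + 4 * c2 + 5 * c3 + 6 * c4 + 4 * c5 + 2 * c6 + 3 * c7);
  - (4 * c1 + 4 * c2 + 5 * c3 + 6 * c4 + 4 * c5 + 2 * c6 + 3 * c7);
  - (5 * c1 + 5 * c2 + 5 * c3 + 6 * c4 + 4 * c5 + 2 * c6 + 3 * c7);
  - (6 * c1 + 6 * c2 + 6 * c3 + 6 * c4 + 4 * c5 + 2 * c6 + 3 * c7);
  - (4 * c1 + 4 * c2 + 4 * c3 + 4 * c4 + 2 * c5 + c6 + 2 * c7);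
  - (2 * c1 + 2 * c2 + 2 * c3 + 2 * c4 + c5 + c7);
  - (3 * c1 + 3 * c2 + 3 * c3 + 3 * c4 + 2 * c5 + c6 + c7)] k).
by case: k k_n => [|[|[|[|[|[|[|[|k]]]]]]]] // _; rewrite /weightE7 /=;
  rewrite !(rmorphN, rmorphD, rmorphM) /= -E1 -E2 -E3 -E4 -E5 -E6 -E7; lra.
Qed.
End TypeE.

(** * Codes and root lattices *)

Section RootLattices.
Context {R : realType} {V : vectType R} (b : {dot V for idfun}) (L : set V).
Context (m : nat).

Lemma typeA_codes n (C : {set 'rV['Z_n.+1]_m}) : (0 < n)%N ->
  typeA b L n -> is_code C ->
  [/\ odd n -> even_unimodular_iff b L C (typeII_Z n.+1 C)
    & ~~ odd n -> even_unimodular_iff b L C (self_dual C)].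
Proof.
move=> n_gt0 [e Le gramA] codeC.
have gram (i j : 'I_n) : b (tnth e i) (tnth e j) =
    if i == j then 2 else if adjT n (n - 1) i.+1 j.+1 then -1 else 0.
  by rewrite gramA (@adjA_T n) //= ltn_ord.
have p_n : (n - 1 < n)%N by rewrite subn1 prednK.
have n_n : (0 < n <= n)%N by rewrite n_gt0 /=.
have w0 : weightA n 0 = 0 :> R by rewrite /weightA mul0r.
have order k (_ : (0 < k <= n)%N) := weightA_order (R := R) n k.
have cop : coprime n n.+1 by exact: coprimenS.
split=> n_parity.
  apply: (cyclic_diagram_even (N := n.+1) (q := n) Le p_n gram n_n w0
    (cartan_weightA n_gt0) n_gt0 order (weightA_generates n_gt0) erefl cop) => //.
  by rewrite /= negbK.
exact: (cyclic_diagram_odd (N := n.+1) (q := n) Le p_n gram n_n w0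
  (cartan_weightA n_gt0) n_gt0 order (weightA_generates n_gt0) erefl cop).
Qed.

Section TypeDCodes.
Context (p : nat) (e : (p.+2).-tuple V) (Le : is_Zbasis L e).
Hypothesis p_gt1 : (1 < p)%N.
Hypothesis gram : forall i j : 'I_p.+2, b (tnth e i) (tnth e j) =
  if i == j then 2 else if adjD p.+2 i.+1 j.+1 then -1 else 0.

Let p_n : (p < p.+2)%N. Proof. exact: ltnW. Qed.
Let gramT (i j : 'I_p.+2) : b (tnth e i) (tnth e j) =
  if i == j then 2 else if adjT p.+2 p i.+1 j.+1 then -1 else 0.
Proof. by rewrite gram /adjD /adjT !subSS !subn0. Qed.
Let spinor0 : spinor p 0 = 0 :> R.
Proof. by rewrite /spinor mul0r. Qed.

Lemma typeD_odd_codes (C : {set 'rV['Z_4]_m}) : odd p -> is_code C ->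
  even_unimodular_iff b L C (typeII_Z 4 C).
Proof.
move=> p_odd codeC; have [sE s1 s2] := @spinorE R p p_gt1.
have last_n : (0 < p.+2 <= p.+2)%N by rewrite leqnn.
apply: (cyclic_diagram_even (N := 4) (q := p.+2) Le p_n gramT last_n spinor0
  (cartan_spinor p_gt1) isT _ _ s2) => //.
- apply: (vertexD_ind p_gt1) => [k /andP[_ k_p]||].
  + rewrite sE //; have -> : 4 * (k%:R / 2) = (2 * k)%:R :> R by rewrite natrM; field.
    exact: natr_int.
  + by rewrite s1 mulrC divfK ?pnatr_eq0 ?natr_int.
  + by rewrite s2 mulrC divfK ?pnatr_eq0 ?natr_int.
- by move=> a a0; exact: spinor_generates.
- by rewrite (@coprimeXr 2 _ 2) // coprimen2 /= negbK.
Qed.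

Lemma typeD_even_codes (C : {set 'rV[F2uF2]_m}) : ~~ odd p -> is_code C ->
  [/\ ~~ (4 %| p.+2)%N -> even_unimodular_iff b L C (typeII_F2u C)
    & (4 %| p.+2)%N -> even_unimodular_iff b L C (typeIV_F2u C)].
Proof.
move=> p_even codeC; have [sE s1 s2] := @spinorE R p p_gt1.
have [v0 vE v1 v2] := @vectorDE R p p_gt1.
have nE : p.+2%:R = 2 * (p.+2)./2%:R :> R.
  by rewrite -natrM mul2n even_halfK //= negbK.
have order_s : L (comb e (spinor p) *+ 2).
  apply: (fundamental_order Le) => k; move: k.
  apply: (vertexD_ind p_gt1) => [k /andP[_ k_p]||].
  + by rewrite sE // mulrC divfK ?natr_int // pnatr_eq0.
  + rewrite s1.
    have -> : p%:R = 2 * p./2%:R :> R by rewrite -natrM mul2n even_halfK.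
    have -> : 2 * (2 * p./2%:R / 4) = p./2%:R :> R by field.
    exact: natr_int.
  + rewrite s2 nE.
    have -> : 2 * (2 * (p.+2)./2%:R / 4) = (p.+2)./2%:R :> R by field.
    exact: natr_int.
have order_v : L (comb e (vectorD p) *+ 2).
  apply: (fundamental_order Le) => k; move: k; apply: (vertexD_ind p_gt1) => [k k_p||].
  + by rewrite vE // mulr1 natr_int.
  + by rewrite v1 mulrC divfK ?rpred1 // pnatr_eq0.
  + by rewrite v2 mulrC divfK ?rpred1 // pnatr_eq0.
have last_n : (0 < p.+2 <= p.+2)%N by rewrite leqnn.
have first_n : (0 < 1 <= p.+2)%N by [].
have dot_s := dot_fundamental p_n gramT last_n spinor0 (cartan_spinor p_gt1).
have dot_v := dot_fundamental p_n gramT first_n v0 (cartan_vectorD p_gt1).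
have ss : b (comb e (spinor p)) (comb e (spinor p)) = (p.+2)./2%:R / 2 :> R.
  by rewrite dot_s s2 nE; field.
have vv : b (comb e (vectorD p)) (comb e (vectorD p)) = 1 :> R.
  by rewrite dot_v vE //=; exact: ltnW.
have sv : b (comb e (spinor p)) (comb e (vectorD p)) = 1 / 2 :> R.
  by rewrite dot_s v2.
have cover x : dual_lattice b L x -> exists y z : int,
    L (x - comb e (spinor p) *~ y - comb e (vectorD p) *~ z).
  move=> /(dual_comb_onto Le p_n gramT)[a [a0 -> row]].
  have [y [z ayz]] := spinor_vector_generate p_gt1 p_even a0 row.
  exists y, z; rewrite -!scaler_int !combZ !combB; exact: (comb_lattice Le).
have [codes2 codes4] := klein_glue_codes Le (diagram_even Le gramT)
  (fundamental_dual Le p_n gramT spinor0 (cartan_spinor p_gt1))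
  (fundamental_dual Le p_n gramT v0 (cartan_vectorD p_gt1))
  order_s order_v cover ss vv sv codeC.
by split=> n4; [apply: codes2 | apply: codes4]; move: n4 p_even; lia.
Qed.

End TypeDCodes.

Lemma typeE6_codes (C : {set 'rV['Z_3]_m}) :
  typeE b L 6 -> is_code C -> even_unimodular_iff b L C (self_dual C).
Proof.
move=> [_ [e Le gram]].
exact: (cyclic_diagram_odd (p := 3) Le isT gram (k0 := 5) isT erefl cartan_weightE6
  (N := 3) (q := 4) isT weightE6_order weightE6_generates erefl erefl).
Qed.

Lemma typeE7_codes (C : {set 'rV['Z_2]_m}) :
  typeE b L 7 -> is_code C -> even_unimodular_iff b L C (typeII_Z 2 C).
Proof.
move=> [_ [e Le gram]].
exact: (cyclic_diagram_even (p := 4) Le isT gram (k0 := 1%N) isT erefl cartan_weightE7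
  (N := 2) (q := 3) isT weightE7_order weightE7_generates erefl erefl).
Qed.

End RootLattices.

Theorem theorem1p1 (R : realType) (V : vectType R) (b : {dot V for idfun})
    (L : set V) (n m : nat) :
  (0 < n)%N -> (0 < m)%N -> is_lattice L ->
  [/\ (* type A_n, codes over Z/(n+1)Z *)
      typeA b L n ->
      forall C : {set 'rV['Z_n.+1]_m}, is_code C ->
      [/\ odd n -> even_unimodular_iff b L C (typeII_Z n.+1 C)
        & ~~ odd n -> even_unimodular_iff b L C (self_dual C)],
      (* type D_n with n odd, codes over Z/4Z *)
      typeD b L n -> odd n ->
      forall C : {set 'rV['Z_4]_m}, is_code C ->
      even_unimodular_iff b L C (typeII_Z 4 C),
      (* type D_n with n even, codes over F_2 + u F_2 *)
      typeD b L n -> ~~ odd n ->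
      forall C : {set 'rV[F2uF2]_m}, is_code C ->
      [/\ ~~ (4 %| n)%N -> even_unimodular_iff b L C (typeII_F2u C)
        & (4 %| n)%N -> even_unimodular_iff b L C (typeIV_F2u C)],
      (* type E_6, codes over Z/3Z *)
      typeE b L n -> n = 6%N ->
      forall C : {set 'rV['Z_3]_m}, is_code C ->
      even_unimodular_iff b L C (self_dual C)
    & (* type E_7, codes over Z/2Z *)
      typeE b L n -> n = 7%N ->
      forall C : {set 'rV['Z_2]_m}, is_code C ->
      even_unimodular_iff b L C (typeII_Z 2 C)].
Proof.
move=> n_gt0 _ _; split.
- by move=> LA C codeC; exact: typeA_codes.
- case=> n_ge4 [e Le gram] n_odd C codeC.
  have [p nE] : exists p, n = p.+2 by exists (n - 2)%N; lia.
  subst n; have p_odd : odd p by rewrite -[odd p]negbK.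
  exact (typeD_odd_codes Le n_ge4 gram p_odd codeC).
- case=> n_ge4 [e Le gram] n_even C codeC.
  have [p nE] : exists p, n = p.+2 by exists (n - 2)%N; lia.
  subst n; have p_even : ~~ odd p by rewrite -[odd p]negbK.
  exact (typeD_even_codes Le n_ge4 gram p_even codeC).
- by move=> LE n6; rewrite n6 in LE => C; exact: typeE6_codes.
- by move=> LE n7; rewrite n7 in LE => C; exact: typeE7_codes.
Qed.
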